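(* Let $\Omega\subset\mathbb{H}$ be an axially symmetric domain. Then $\partial\circ\Delta=\Delta\circ\frac{\partial}{\partial x}$ on $\mathcal{SR}(\Omega)$, i.e. for every slice-regular function $f\in\mathcal{SR}(\Omega)$, $$\partial(\Delta f)=\Delta\left(\frac{\partial f}{\partial x}\right)\quad\text{on }\Omega.$$
   Context: $\mathbb{H}$ is the skew field of quaternions, with elements $x=x_0+x_1i+x_2j+x_3k$, $\mathbb{S}=\{J\in\mathbb{H}: J^2=-1\}$; $\Delta=\sum_{i=0}^3\partial^2/\partial x_i^2$ is the Laplacian of $\mathbb{R}^4\simeq\mathbb{H}$. For an open set $D\subseteq\mathbb{C}$ invariant under complex conjugation, put $\Omega_D=\{\alpha+J\beta:\ \alpha+i\beta\in D,\ J\in\mathbb{S}\}\subseteq\mathbb{H}$. An axially symmetric domain is a connected open set $\Omega=\Omega_D$ of this form. A stem function on $D$ is a map $F=F_1+\imath F_2:D\to\mathbb{H}\otimes_{\mathbb{R}}\mathbb{C}$ ($F_1,F_2$ $\mathbb{H}$-valued, $\imath$ the central imaginary unit of the factor $\mathbb{C}$) with $F(\overline z)=\overline{F(z)}$, conjugation acting on the factor $\mathbb{C}$. It induces the slice function $f=\mathcal{I}(F):\Omega_D\to\mathbb{H}$, $f(\alpha+J\beta)=F_1(\alpha+i\beta)+JF_2(\alpha+i\beta)$. For $F$ of class $C^1$ the slice derivative is $\frac{\partial f}{\partial x}=\mathcal{I}(\frac{\partial F}{\partial z})$ with $\frac{\partial}{\partial z}=\frac12(\partial_\alpha-\imath\partial_\beta)$.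 $f$ is slice-regular if $F$ is holomorphic, i.e. $\frac12(\partial_\alpha+\imath\partial_\beta)F=0$; $\mathcal{SR}(\Omega)$ is the set of slice-regular functions. The conjugated Cauchy-Riemann-Fueter operator is $\partial=\frac12\left(\frac{\partial}{\partial x_0}-i\frac{\partial}{\partial x_1}-j\frac{\partial}{\partial x_2}-k\frac{\partial}{\partial x_3}\right)$, with $i,j,k$ acting by left multiplication. *)

(* Defs.v *)
From Stdlib Require Import Reals Lra Psatz.
From Coquelicot Require Import Coquelicot.
Open Scope R_scope.

(** * Quaternions *)

(** [(x0, x1, x2, x3)] is x0 + x1 i + x2 j + x3 k.  The real vector space
    structure and the topology of R^4 are those of the product. *)
Definition H : Type := (R * R * R * R)%type.

Definition H1 : H := (1, 0, 0, 0).
Definition Hi : H := (0, 1, 0, 0).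
Definition Hj : H := (0, 0, 1, 0).
Definition Hk : H := (0, 0, 0, 1).

Definition Hmult (x y : H) : H :=
  let '(x0, x1, x2, x3) := x in
  let '(y0, y1, y2, y3) := y in
  (x0 * y0 - x1 * y1 - x2 * y2 - x3 * y3,
   x0 * y1 + x1 * y0 + x2 * y3 - x3 * y2,
   x0 * y2 - x1 * y3 + x2 * y0 + x3 * y1,
   x0 * y3 + x1 * y2 - x2 * y1 + x3 * y0).

Definition sphereS (J : H) : Prop := Hmult J J = opp H1.

(** alpha + J beta *)
Definition slice_point (alpha beta : R) (J : H) : H :=
  plus (scal alpha H1) (scal beta J).

(** * Differential operators on quaternion-valued functions *)

(** [Derive] is total; every function it is applied to in the main statement
    is smooth, because slice-regular functions are real analytic. *)
Definition DeriveH (g : R -> H) (t : R) : H :=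
  (Derive (fun s => fst (fst (fst (g s)))) t,
   Derive (fun s => snd (fst (fst (g s)))) t,
   Derive (fun s => snd (fst (g s))) t,
   Derive (fun s => snd (g s)) t).

(** Directional derivative at [x] along [e]; for [e] = 1, i, j, k these are the
    partial derivatives with respect to x0, x1, x2, x3. *)
Definition partialH (e : H) (f : H -> H) (x : H) : H :=
  DeriveH (fun t => f (plus x (scal t e))) 0.

Definition laplacian (f : H -> H) (x : H) : H :=
  plus (plus (plus (partialH H1 (partialH H1 f) x)
                   (partialH Hi (partialH Hi f) x))
             (partialH Hj (partialH Hj f) x))
       (partialH Hk (partialH Hk f) x).

Definition CRF_conj (f : H -> H) (x : H) : H :=
  scal (/ 2)
    (minus (minus (minus (partialH H1 f x)
                         (Hmult Hi (partialH Hi f x)))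
                  (Hmult Hj (partialH Hj f x)))
           (Hmult Hk (partialH Hk f x))).

(** * Stem functions *)

(** The pair [(a, b)] is a + ı b in H ⊗ C. *)
Definition HC : Type := (H * H)%type.

Definition HC_conj (w : HC) : HC := (fst w, opp (snd w)).
Definition HC_muli (w : HC) : HC := (opp (snd w), fst w).

Definition DeriveHC (g : R -> HC) (t : R) : HC :=
  (DeriveH (fun s => fst (g s)) t, DeriveH (fun s => snd (g s)) t).

Definition d_alpha (F : C -> HC) (z : C) : HC :=
  DeriveHC (fun a => F (a, Im z)) (Re z).
Definition d_beta (F : C -> HC) (z : C) : HC :=
  DeriveHC (fun b => F (Re z, b)) (Im z).

Definition dz (F : C -> HC) (z : C) : HC :=
  scal (/ 2) (minus (d_alpha F z) (HC_muli (d_beta F z))).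
Definition dzbar (F : C -> HC) (z : C) : HC :=
  scal (/ 2) (plus (d_alpha F z) (HC_muli (d_beta F z))).

(** Functions on [D] are restrictions of total functions; since [D] is open,
    none of the notions below depends on the values outside [D]. *)
Definition C1_on (D : C -> Prop) (F : C -> HC) : Prop :=
  forall z, D z ->
    ex_derive (fun a : R => F (a, Im z)) (Re z) /\
    ex_derive (fun b : R => F (Re z, b)) (Im z) /\
    continuous (d_alpha F) z /\
    continuous (d_beta F) z.

Definition stem (D : C -> Prop) (F : C -> HC) : Prop :=
  forall z, D z -> F (Cconj z) = HC_conj (F z).

Definition holomorphic (D : C -> Prop) (F : C -> HC) : Prop :=
  C1_on D F /\ forall z, D z -> dzbar F z = zero.

(** * Axially symmetric domains and slice functions *)

Definition connected {T : UniformSpace} (A : T -> Prop) : Prop :=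
  forall U V : T -> Prop, open U -> open V ->
    (forall x, A x -> U x \/ V x) ->
    (exists x, A x /\ U x) -> (exists x, A x /\ V x) ->
    exists x, A x /\ U x /\ V x.

Definition conj_invariant (D : C -> Prop) : Prop :=
  forall z, D z -> D (Cconj z).

Definition Omega (D : C -> Prop) (x : H) : Prop :=
  exists (alpha beta : R) (J : H),
    D (alpha, beta) /\ sphereS J /\ x = slice_point alpha beta J.

(** [f] coincides on [Omega D] with the slice function I(F). *)
Definition induces (D : C -> Prop) (F : C -> HC) (f : H -> H) : Prop :=
  forall (alpha beta : R) (J : H), D (alpha, beta) -> sphereS J ->
    f (slice_point alpha beta J) =
    plus (fst (F (alpha, beta))) (Hmult J (snd (F (alpha, beta)))).

(** [Omega D] is then open. *)
Definition axially_symmetric_domain (D : C -> Prop) : Prop :=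
  open D /\ conj_invariant D /\ connected (Omega D).

Definition slice_regular (D : C -> Prop) (f : H -> H) : Prop :=
  exists F : C -> HC, stem D F /\ holomorphic D F /\ induces D F f.

(** [g] coincides on [Omega D] with the slice derivative of [f].  Existence and
    uniqueness of [g] on [Omega D] are proved below. *)
Definition is_slice_derivative (D : C -> Prop) (f g : H -> H) : Prop :=
  exists F : C -> HC,
    stem D F /\ C1_on D F /\ induces D F f /\ induces D (dz F) g.

(** * The slice derivative is well defined *)

Ltac unfold_H := cbv - [Rplus Rmult Ropp Rminus Rinv Rdiv IZR not].

Lemma H_eq (a b c d a' b' c' d' : R) :
  a = a' -> b = b' -> c = c' -> d = d' -> (a, b, c, d) = (a', b', c', d') :> H.
Proof. now intros -> -> -> ->. Qed.

Lemma H_inj (a b c d a' b' c' d' : R) :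
  (a, b, c, d) = (a', b', c', d') :> H -> a = a' /\ b = b' /\ c = c' /\ d = d'.
Proof. intros E; injection E; auto. Qed.

Lemma sphereS_coord (a b c d : R) :
  sphereS (a, b, c, d) <-> a = 0 /\ b * b + c * c + d * d = 1.
Proof.
unfold_H; split.
- intros E; apply H_inj in E; destruct E as (E0 & E1 & E2 & E3).
  assert (Ha : a = 0).
  { destruct (Req_dec a 0) as [?|Na]; trivial.
    assert (b = 0) by (apply (Rmult_eq_reg_l a); [ lra | exact Na ]).
    assert (c = 0) by (apply (Rmult_eq_reg_l a); [ lra | exact Na ]).
    assert (d = 0) by (apply (Rmult_eq_reg_l a); [ lra | exact Na ]).
    subst; nra. }
  split; [ exact Ha | subst; lra ].
- intros [-> E]; apply H_eq; lra.
Qed.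

Lemma sphereS_opp (J : H) : sphereS J -> sphereS (opp J).
Proof.
destruct J as [[[a b] c] d]; intros HJ; apply sphereS_coord in HJ.
apply (proj2 (sphereS_coord (- a) (- b) (- c) (- d))); lra.
Qed.

Lemma sphereS_Hi : sphereS Hi.
Proof. apply (proj2 (sphereS_coord 0 1 0 0)); lra. Qed.

Lemma stem_unique (D : C -> Prop) (F G : C -> HC) (f : H -> H) :
  induces D F f -> induces D G f -> forall z, D z -> F z = G z.
Proof.
intros IF IG [a b] Dz.
assert (E1 := IF a b Hi Dz sphereS_Hi); rewrite (IG a b Hi Dz sphereS_Hi) in E1.
assert (E2 := IF a b (opp Hi) Dz (sphereS_opp _ sphereS_Hi));
  rewrite (IG a b (opp Hi) Dz (sphereS_opp _ sphereS_Hi)) in E2.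
clear IF IG.
destruct (F (a, b)) as [[[[p0 p1] p2] p3] [[[q0 q1] q2] q3]].
destruct (G (a, b)) as [[[[r0 r1] r2] r3] [[[s0 s1] s2] s3]].
revert E1 E2; unfold_H; intros E1 E2.
apply H_inj in E1; apply H_inj in E2.
apply f_equal2; apply H_eq; lra.
Qed.

Lemma open_alpha (D : C -> Prop) (a b : R) :
  open D -> D (a, b) -> locally a (fun t : R => D (t, b)).
Proof.
intros OD Dz; destruct (OD _ Dz) as [e He]; exists e; intros t Ht.
apply He; split; [ exact Ht | apply ball_center ].
Qed.

Lemma open_beta (D : C -> Prop) (a b : R) :
  open D -> D (a, b) -> locally b (fun t : R => D (a, t)).
Proof.
intros OD Dz; destruct (OD _ Dz) as [e He]; exists e; intros t Ht.
apply He; split; [ apply ball_center | exact Ht ].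
Qed.

Lemma DeriveHC_ext_loc (g h : R -> HC) (t : R) :
  locally t (fun s => g s = h s) -> DeriveHC g t = DeriveHC h t.
Proof.
intros L; unfold DeriveHC, DeriveH.
apply f_equal2; apply H_eq; apply Derive_ext_loc;
  revert L; apply filter_imp; now intros s ->.
Qed.

Lemma dz_ext (D : C -> Prop) (F G : C -> HC) :
  open D -> (forall z, D z -> F z = G z) -> forall z, D z -> dz F z = dz G z.
Proof.
intros OD E [a b] Dz; unfold dz, d_alpha, d_beta; simpl.
rewrite (DeriveHC_ext_loc (fun t => F (t, b)) (fun t => G (t, b))).
rewrite (DeriveHC_ext_loc (fun t => F (a, t)) (fun t => G (a, t))).
reflexivity.
- generalize (open_beta D a b OD Dz); apply filter_imp; auto.
- generalize (open_alpha D a b OD Dz); apply filter_imp; auto.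
Qed.

Lemma slice_derivative_unique (D : C -> Prop) (f g h : H -> H) :
  open D -> is_slice_derivative D f g -> is_slice_derivative D f h ->
  forall x, Omega D x -> g x = h x.
Proof.
intros OD (F & _ & _ & IF & Ig) (G & _ & _ & IG & Ih) x (a & b & J & Dz & HJ & ->).
rewrite (Ig a b J Dz HJ), (Ih a b J Dz HJ).
now rewrite (dz_ext D F G OD (stem_unique D F G f IF IG) _ Dz).
Qed.

Lemma is_derive_fst {V W : NormedModule R_AbsRing} (g : R -> V * W) t l :
  is_derive g t l -> is_derive (fun s => fst (g s)) t (fst l).
Proof.
intros Hg.
unfold is_derive.
apply (filterdiff_ext_lin _ (fun y : R => fst (scal y l : prod_NormedModule R_AbsRing V W)));
  [ | reflexivity ].
apply (filterdiff_comp' (V := prod_NormedModule R_AbsRing V W) g fst t _ fst);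
  [ exact Hg | ].
apply filterdiff_linear, is_linear_fst.
Qed.

Lemma is_derive_snd {V W : NormedModule R_AbsRing} (g : R -> V * W) t l :
  is_derive g t l -> is_derive (fun s => snd (g s)) t (snd l).
Proof.
intros Hg.
unfold is_derive.
apply (filterdiff_ext_lin _ (fun y : R => snd (scal y l : prod_NormedModule R_AbsRing V W)));
  [ | reflexivity ].
apply (filterdiff_comp' (V := prod_NormedModule R_AbsRing V W) g snd t _ snd);
  [ exact Hg | ].
apply filterdiff_linear, is_linear_snd.
Qed.

Lemma is_derive_DeriveH (g : R -> H) (t : R) (l : H) :
  is_derive g t l -> DeriveH g t = l.
Proof.
intros Hg; destruct l as [[[l0 l1] l2] l3]; unfold DeriveH.
assert (Ha := is_derive_fst _ _ _ Hg); assert (Hb := is_derive_fst _ _ _ Ha).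
apply H_eq; apply is_derive_unique.
- exact (is_derive_fst _ _ _ Hb).
- exact (is_derive_snd _ _ _ Hb).
- exact (is_derive_snd _ _ _ Ha).
- exact (is_derive_snd _ _ _ Hg).
Qed.

Lemma is_derive_DeriveHC (g : R -> HC) (t : R) (l : HC) :
  is_derive g t l -> DeriveHC g t = l.
Proof.
intros Hg; destruct l as [l1 l2]; unfold DeriveHC; apply f_equal2.
- exact (is_derive_DeriveH _ _ _ (is_derive_fst _ _ _ Hg)).
- exact (is_derive_DeriveH _ _ _ (is_derive_snd _ _ _ Hg)).
Qed.

Lemma ex_derive_DeriveHC (g : R -> HC) (t : R) :
  ex_derive g t -> is_derive g t (DeriveHC g t).
Proof. intros [l Hl]; now rewrite (is_derive_DeriveHC g t l Hl). Qed.

Lemma is_derive_HC_conj (g : R -> HC) (t : R) (l : HC) :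
  is_derive g t l -> is_derive (fun s => HC_conj (g s)) t (HC_conj l).
Proof.
intros Hg.
apply (filterdiff_ext_lin _ (fun y : R => HC_conj (scal y l))).
- apply (filterdiff_comp' g HC_conj t _ HC_conj); [ exact Hg | ].
  apply filterdiff_linear.
  apply (is_linear_prod (K := R_AbsRing) fst (fun w : HC => opp (snd w))).
  + apply is_linear_fst.
  + set (V1 := R_NormedModule).
    set (V3 := prod_NormedModule R_AbsRing
                 (prod_NormedModule R_AbsRing (prod_NormedModule R_AbsRing V1 V1) V1) V1).
    apply (is_linear_comp (U := prod_NormedModule R_AbsRing V3 V3) (V := V3) snd opp);
      [ apply is_linear_snd | apply is_linear_opp ].
- intros y; destruct l as [[[[p0 p1] p2] p3] [[[q0 q1] q2] q3]].
  unfold_H; apply f_equal2; apply H_eq; ring.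
Qed.

Lemma dz_stem (D : C -> Prop) (F : C -> HC) :
  open D -> conj_invariant D -> stem D F -> C1_on D F -> stem D (dz F).
Proof.
intros OD CD SF CF [a b] Dz.
assert (Dz' : D (a, - b)) by exact (CD _ Dz).
destruct (CF _ Dz) as (Ea & Eb & _); simpl in Ea, Eb.
apply ex_derive_DeriveHC in Ea; apply ex_derive_DeriveHC in Eb.
unfold dz, d_alpha, d_beta; simpl.
assert (Xa : DeriveHC (fun t => F (t, - b)) a
             = HC_conj (DeriveHC (fun t => F (t, b)) a)).
{ apply is_derive_DeriveHC.
  apply (is_derive_ext_loc (fun t => HC_conj (F (t, b)))).
  - generalize (open_alpha D a b OD Dz); apply filter_imp; intros t Dt.
    exact (eq_sym (SF (t, b) Dt)).
  - now apply is_derive_HC_conj. }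
assert (Xb : DeriveHC (fun t => F (a, t)) (- b)
             = opp (HC_conj (DeriveHC (fun t => F (a, t)) b))).
{ apply is_derive_DeriveHC.
  apply (is_derive_ext_loc (fun t => HC_conj (F (a, - t)))).
  - generalize (open_beta D a (- b) OD Dz'); apply filter_imp; intros t Dt.
    rewrite <- (Ropp_involutive t) at 2.
    exact (eq_sym (SF (a, - t) (CD (a, t) Dt))).
  - replace (opp (HC_conj (DeriveHC (fun t => F (a, t)) b)))
      with (scal (-1) (HC_conj (DeriveHC (fun t => F (a, t)) b)))
      by exact (scal_opp_one (K := R_Ring) _).
    apply (is_derive_comp (fun t => HC_conj (F (a, t))) Ropp).
    + rewrite Ropp_involutive; now apply is_derive_HC_conj.
    + auto_derive; trivial; ring. }
rewrite Xa, Xb.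
destruct (DeriveHC (fun t => F (t, b)) a) as [[[[p0 p1] p2] p3] [[[q0 q1] q2] q3]].
destruct (DeriveHC (fun t => F (a, t)) b) as [[[[r0 r1] r2] r3] [[[s0 s1] s2] s3]].
unfold_H; apply f_equal2; apply H_eq; lra.
Qed.

Definition slice_fun (F : C -> HC) (x : H) : H :=
  let '(x0, x1, x2, x3) := x in
  let r := sqrt (x1 * x1 + x2 * x2 + x3 * x3) in
  plus (fst (F (x0, r)))
    (scal (/ r) (Hmult (0, x1, x2, x3) (snd (F (x0, r))))).

Lemma slice_fun_induces (D : C -> Prop) (F : C -> HC) :
  stem D F -> induces D F (slice_fun F).
Proof.
intros SF a b [[[j0 j1] j2] j3] Dz HJ.
apply sphereS_coord in HJ; destruct HJ as [-> HJ].
replace (slice_point a b (0, j1, j2, j3)) with ((a, b * j1, b * j2, b * j3) : H)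
  by (unfold_H; apply H_eq; ring).
unfold slice_fun; cbv zeta.
replace (b * j1 * (b * j1) + b * j2 * (b * j2) + b * j3 * (b * j3)) with (Rsqr b)
  by (replace (Rsqr b) with (Rsqr b * (j1 * j1 + j2 * j2 + j3 * j3))
        by (rewrite HJ; ring); unfold Rsqr; ring).
rewrite sqrt_Rsqr_abs.
assert (Sz := SF (a, b) Dz); unfold Cconj, HC_conj in Sz; simpl in Sz.
destruct (Req_dec b 0) as [Hb|Hb].
- subst b; rewrite Ropp_0 in Sz; rewrite Rabs_R0.
  destruct (F (a, 0)) as [[[[p0 p1] p2] p3] [[[q0 q1] q2] q3]].
  assert (Sq := f_equal snd Sz); clear Sz; revert Sq; unfold_H; intros Sq.
  apply H_inj in Sq; destruct Sq as (Q0 & Q1 & Q2 & Q3).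
  assert (q0 = 0) by lra; assert (q1 = 0) by lra;
    assert (q2 = 0) by lra; assert (q3 = 0) by lra; subst.
  apply H_eq; ring.
- destruct (Rcase_abs b) as [Nb|Pb].
  + rewrite (Rabs_left b Nb), Sz; clear Sz.
    destruct (F (a, b)) as [[[[p0 p1] p2] p3] [[[q0 q1] q2] q3]].
    unfold_H; apply H_eq; field; lra.
  + rewrite (Rabs_right b Pb); clear Sz.
    destruct (F (a, b)) as [[[[p0 p1] p2] p3] [[[q0 q1] q2] q3]].
    unfold_H; apply H_eq; field; lra.
Qed.

Lemma slice_derivative_exists (D : C -> Prop) (f : H -> H) :
  open D -> conj_invariant D -> slice_regular D f ->
  exists g, is_slice_derivative D f g.
Proof.
intros OD CD (F & SF & [CF _] & IF).
exists (slice_fun (dz F)), F.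
exact (conj SF (conj CF (conj IF (slice_fun_induces D _ (dz_stem D F OD CD SF CF))))).
Qed.

(* Main.v *)
(** The stem of a slice-regular function [f] has four holomorphic components.
Cauchy's formula on a small circle, with the kernel split into its even and odd
parts in [beta], writes [f (x) = U (x0, |Im x|^2) + Im x * W (x0, |Im x|^2)] with
[U], [W] smooth in both variables, across the real axis too.  Here [U] and [W] are
the first members of two sequences of integrals, closed under both partial
derivatives by explicit rules, from which
[Delta f = -4 (U 1 + Im x * W 1)] and
[df/dx = (W 0 - 2 s W 1) + 2 Im x * U 1], where [s = |Im x|^2].  The identity
is then polynomial algebra in the members of the two sequences. *)

Require Import Defs.
From Stdlib Require Import Reals.
From Coquelicot Require Import Coquelicot.
From Stdlib Require Import Lra Psatz.

(** * Complex-valued functions of a real variable *)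

(** [holomorphic] provides stems of class C^1 only, while the identity involves three derivatives of
    [f]; since [Derive] is total, each of them has to be shown to exist before its value means
    anything. Cauchy's formula supplies the missing smoothness. It is obtained here from a homotopy
    that uses a continuous first derivative, differentiation under the integral sign and the
    fundamental theorem of calculus. The other obstacle is the real axis: [|Im x|] is not
    differentiable there and [W] is formally a quotient by [be]. The integral kernels depend on [be]
    through [s = be^2] alone and remain regular for [s] near 0 of either sign. For [n = 0] the rules
    of the two sequences are the Cauchy-Riemann equations in the variables [(al, s)]:
    [W_al = -2 U_s] and [U_al = W + 2 s W_s]. The later members are normalized derivatives,
    [U n = (-1)^n / n! * d^n U / ds^n] and likewise for [W]; this normalization comes from raising
    the exponent of the kernel's denominator. *)

Definition is_cderive (f : R -> C) (t : R) (l : C) : Prop :=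
  is_derive (fun s => Re (f s)) t (Re l) /\ is_derive (fun s => Im (f s)) t (Im l).

Definition ccontinuous {T : UniformSpace} (f : T -> C) (x : T) : Prop :=
  continuous (fun y => Re (f y)) x /\ continuous (fun y => Im (f y)) x.

Lemma is_cderive_eq (f : R -> C) (t : R) (l l' : C) :
  is_cderive f t l -> l = l' -> is_cderive f t l'.
Proof. now intros H <-. Qed.

Lemma is_cderive_ext (f g : R -> C) (t : R) (l : C) :
  (forall s, f s = g s) -> is_cderive f t l -> is_cderive g t l.
Proof.
intros E [H1 H2]; split; (eapply is_derive_ext; [ | eassumption ]); simpl; intros s;
  now rewrite E.
Qed.

Lemma is_cderive_ccontinuous (f : R -> C) (t : R) (l : C) :
  is_cderive f t l -> ccontinuous f t.
Proof.
intros [H1 H2]; split; apply (ex_derive_continuous (K := R_AbsRing) (V := R_NormedModule)).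
- now exists (Re l).
- now exists (Im l).
Qed.

Lemma is_cderive_const (c : C) (t : R) : is_cderive (fun _ => c) t 0%C.
Proof. split; apply (is_derive_const (K := R_AbsRing) (V := R_NormedModule)). Qed.

Lemma is_cderive_RtoC (f : R -> R) (t l : R) :
  is_derive f t l -> is_cderive (fun s => RtoC (f s)) t (RtoC l).
Proof.
intros H; split; [ exact H | ].
exact (is_derive_const (K := R_AbsRing) (V := R_NormedModule) 0 t).
Qed.

Lemma is_derive_eq (f : R -> R) (t l l' : R) :
  is_derive f t l -> l = l' -> is_derive f t l'.
Proof. now intros H <-. Qed.

(** [auto_derive] expresses its result with [Derive] of the abstract functions; these terms are
    replaced by the derivatives known from the hypotheses. *)
Ltac derive_known :=
  auto_derive;
  [ repeat split; try (eexists; eassumption); try assumption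
  | repeat match goal with
    | H : is_derive ?f ?t ?l |- context [Derive ?f' ?t] =>
        replace (Derive f' t) with l by (symmetry; apply is_derive_unique; exact H)
    end; try (ring || (field; assumption)) ].

(** Both components of a complex product have this shape, the imaginary one after a change of sign
    in one factor. *)
Lemma is_derive_det (a b c d : R -> R) (t a' b' c' d' : R) :
  is_derive a t a' -> is_derive b t b' -> is_derive c t c' -> is_derive d t d' ->
  is_derive (fun s => a s * b s - c s * d s) t (a' * b t + a t * b' - (c' * d t + c t * d')).
Proof. intros; derive_known. Qed.

(** Both components of [1 / z] have this shape: [a] and [b] are the real and imaginary parts of [z]
    for the first, and minus the imaginary part and the real part for the second. *)
Lemma is_derive_div_norm2 (a b : R -> R) (t a' b' : R) :
  a t ^ 2 + b t ^ 2 <> 0 -> is_derive a t a' -> is_derive b t b' ->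
  is_derive (fun s => a s / (a s ^ 2 + b s ^ 2)) t
    ((a' * (b t ^ 2 - a t ^ 2) - 2 * a t * b t * b') / (a t ^ 2 + b t ^ 2) ^ 2).
Proof. intros; derive_known. Qed.

Lemma is_cderive_plus (f g : R -> C) (t : R) (l m : C) :
  is_cderive f t l -> is_cderive g t m ->
  is_cderive (fun s => (f s + g s)%C) t (l + m)%C.
Proof.
intros [F1 F2] [G1 G2]; split.
- exact (is_derive_plus _ _ _ _ _ F1 G1).
- exact (is_derive_plus _ _ _ _ _ F2 G2).
Qed.

Lemma is_cderive_mult (f g : R -> C) (t : R) (l m : C) :
  is_cderive f t l -> is_cderive g t m ->
  is_cderive (fun s => (f s * g s)%C) t (l * g t + f t * m)%C.
Proof.
intros [F1 F2] [G1 G2]; split.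
- eapply is_derive_eq; [ exact (is_derive_det _ _ _ _ _ _ _ _ _ F1 G1 F2 G2) | ].
  simpl; unfold Re, Im; ring.
- apply (is_derive_ext (fun s => Re (f s) * Im (g s) - (- Im (f s)) * Re (g s)));
    [ intros s; simpl; unfold Re, Im; ring | ].
  eapply is_derive_eq;
    [ exact (is_derive_det _ _ _ _ _ _ _ _ _ F1 G2 (is_derive_opp _ _ _ F2) G1) | ].
  simpl; unfold Re, Im, opp; simpl; ring.
Qed.

Lemma is_cderive_minus (f g : R -> C) (t : R) (l m : C) :
  is_cderive f t l -> is_cderive g t m ->
  is_cderive (fun s => (f s - g s)%C) t (l - m)%C.
Proof.
intros [F1 F2] [G1 G2]; split.
- exact (is_derive_minus _ _ _ _ _ F1 G1).
- exact (is_derive_minus _ _ _ _ _ F2 G2).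
Qed.

Lemma Cnorm2_neq_0 (z : C) : z <> 0%C -> Re z ^ 2 + Im z ^ 2 <> 0.
Proof.
destruct z as [a b]; simpl; intros N E; apply N.
assert (a = 0) by nra; assert (b = 0) by nra; now subst.
Qed.

Lemma is_cderive_inv (f : R -> C) (t : R) (l : C) :
  f t <> 0%C -> is_cderive f t l ->
  is_cderive (fun s => (/ f s)%C) t (- (l * (/ f t * / f t)))%C.
Proof.
intros N [F1 F2]; apply Cnorm2_neq_0 in N; split.
- eapply is_derive_eq; [ exact (is_derive_div_norm2 _ _ _ _ _ N F1 F2) | ].
  simpl; unfold Re, Im in *; field; contradict N; rewrite <- N; ring.
- apply (is_derive_ext (fun s => (- Im (f s)) / ((- Im (f s)) ^ 2 + Re (f s) ^ 2)));
    [ intros s; simpl; unfold Re, Im, Rdiv; f_equal; f_equal; ring | ].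
  eapply is_derive_eq;
    [ refine (is_derive_div_norm2 _ _ _ _ _ _ (is_derive_opp _ _ _ F2) F1) | ];
    simpl; unfold Re, Im, opp in *; simpl in *.
  + intros E; apply N; rewrite <- E; ring.
  + field; contradict N; rewrite <- N; ring.
Qed.

Lemma is_cderive_pow (f : R -> C) (t : R) (l : C) (n : nat) :
  is_cderive f t l ->
  is_cderive (fun s => (f s ^ S n)%C) t (RtoC (INR (S n)) * f t ^ n * l)%C.
Proof.
intros F; induction n as [|n IH].
- apply (is_cderive_ext f); [ intros s; now rewrite Cpow_1_r | ].
  eapply is_cderive_eq; [ exact F | simpl; ring ].
- apply (is_cderive_ext (fun s => f s * f s ^ S n)%C); [ intros s; now rewrite <- Cpow_S | ].
  eapply is_cderive_eq; [ exact (is_cderive_mult _ _ _ _ _ F IH) | ].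
  rewrite (S_INR (S n)), RtoC_plus, Cpow_S; ring.
Qed.

Section Continuity.

Context {T : UniformSpace}.

Lemma ccontinuous_const (c : C) (x : T) : ccontinuous (fun _ => c) x.
Proof. split; apply continuous_const. Qed.

Lemma ccontinuous_RtoC (f : T -> R) (x : T) :
  continuous f x -> ccontinuous (fun y => RtoC (f y)) x.
Proof. intros H; split; [ exact H | apply continuous_const ]. Qed.

Lemma ccontinuous_plus (f g : T -> C) (x : T) :
  ccontinuous f x -> ccontinuous g x -> ccontinuous (fun y => (f y + g y)%C) x.
Proof.
intros [F1 F2] [G1 G2]; split.
- exact (continuous_plus (V := R_NormedModule) _ _ _ F1 G1).
- exact (continuous_plus (V := R_NormedModule) _ _ _ F2 G2).
Qed.

Lemma ccontinuous_minus (f g : T -> C) (x : T) :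
  ccontinuous f x -> ccontinuous g x -> ccontinuous (fun y => (f y - g y)%C) x.
Proof.
intros [F1 F2] [G1 G2]; split.
- exact (continuous_minus (V := R_NormedModule) _ _ _ F1 G1).
- exact (continuous_minus (V := R_NormedModule) _ _ _ F2 G2).
Qed.

Lemma ccontinuous_mult (f g : T -> C) (x : T) :
  ccontinuous f x -> ccontinuous g x -> ccontinuous (fun y => (f y * g y)%C) x.
Proof.
intros [F1 F2] [G1 G2]; split.
- apply (continuous_minus (V := R_NormedModule)
    (fun y => Re (f y) * Re (g y)) (fun y => Im (f y) * Im (g y)));
    now apply (continuous_mult (K := R_AbsRing)).
- apply (continuous_plus (V := R_NormedModule)
    (fun y => Re (f y) * Im (g y)) (fun y => Im (f y) * Re (g y)));
    now apply (continuous_mult (K := R_AbsRing)).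
Qed.

Lemma ccontinuous_pow (f : T -> C) (x : T) (n : nat) :
  ccontinuous f x -> ccontinuous (fun y => (f y ^ n)%C) x.
Proof.
intros F; induction n as [|n IH]; [ apply ccontinuous_const | ].
exact (ccontinuous_mult _ _ _ F IH).
Qed.

Lemma continuous_Rinv_fun (f : T -> R) (x : T) :
  continuous f x -> f x <> 0 -> continuous (fun y => / f y) x.
Proof.
intros F N; apply (continuous_comp f Rinv); [ exact F | ].
now apply continuous_Rinv.
Qed.

Lemma ccontinuous_inv (f : T -> C) (x : T) :
  f x <> 0%C -> ccontinuous f x -> ccontinuous (fun y => (/ f y)%C) x.
Proof.
intros N [F1 F2]; apply Cnorm2_neq_0 in N.
assert (I : continuous (fun y => / (Re (f y) ^ 2 + Im (f y) ^ 2)) x).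
{ apply continuous_Rinv_fun; [ | exact N ].
  apply (continuous_ext (fun y => Re (f y) * Re (f y) + Im (f y) * Im (f y)));
    [ intros y; simpl; ring | ].
  apply (continuous_plus (V := R_NormedModule)
    (fun y => Re (f y) * Re (f y)) (fun y => Im (f y) * Im (f y)));
    now apply (continuous_mult (K := R_AbsRing)). }
split.
- exact (continuous_mult (K := R_AbsRing) _ _ _ F1 I).
- apply (continuous_mult (K := R_AbsRing) (fun y => - Im (f y))); [ | exact I ].
  exact (continuous_opp (V := R_NormedModule) _ _ F2).
Qed.

Lemma ccontinuous_comp (g : C -> C) (f : T -> C) (x : T) :
  ccontinuous f x -> ccontinuous g (f x) -> ccontinuous (fun y => g (f y)) x.
Proof.
intros [F1 F2] [G1 G2].
assert (F : continuous f x).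
{ intros P [e He].
  assert (L1 : locally x (fun y => ball (Re (f x)) e (Re (f y))))
    by exact (F1 (fun u => ball (Re (f x)) e u) (locally_ball (Re (f x)) e)).
  assert (L2 : locally x (fun y => ball (Im (f x)) e (Im (f y))))
    by exact (F2 (fun u => ball (Im (f x)) e u) (locally_ball (Im (f x)) e)).
  change (locally x (fun y => P (f y))).
  generalize (filter_and _ _ L1 L2); apply filter_imp; intros y [Y1 Y2].
  apply He; split; assumption. }
split.
- exact (continuous_comp f (fun z => Re (g z)) x F G1).
- exact (continuous_comp f (fun z => Im (g z)) x F G2).
Qed.

End Continuity.

(** Restates differentiation under the integral sign with a candidate [df] in place of [Derive], so
    that continuity in both variables is checked on an explicit formula. *)
Lemma is_derive_RInt_param_explicit (f df : R -> R -> R) (a b x : R) :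
  locally x (fun u => forall t, is_derive (fun u' => f u' t) u (df u t)) ->
  locally x (fun u => forall t, continuous (f u) t) ->
  (forall t, continuous (fun q : R * R => df (fst q) (snd q)) (x, t)) ->
  is_derive (fun u => RInt (f u) a b) x (RInt (df x) a b).
Proof.
intros Df Cf Cdf.
replace (RInt (df x) a b) with (RInt (fun t => Derive (fun u => f u t) x) a b).
- apply is_derive_RInt_param.
  + revert Df; apply filter_imp; intros u Hu t _; now exists (df u t).
  + intros t _; apply continuity_2d_pt_filterlim.
    assert (E : Derive (fun z : R => f z t) x = df x t)
      by exact (is_derive_unique _ _ _ (locally_singleton _ _ Df t)).
    cbv beta; rewrite E.
    apply (filterlim_ext_loc (fun q : R * R => df (fst q) (snd q)));
      [ | exact (Cdf t) ].
    (* On a whole neighbourhood of [(x, t)] the function [Derive] coincides with [df], hence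
       inherits its continuity. *)
    destruct Df as [e He]; exists e; intros [u s] [Hu _]; simpl.
    symmetry; apply is_derive_unique; exact (He u Hu s).
  + revert Cf; apply filter_imp; intros u Hu.
    apply (ex_RInt_continuous (V := R_CompleteNormedModule)); intros t _; apply Hu.
- apply RInt_ext; intros t _; apply is_derive_unique.
  exact (locally_singleton _ _ Df t).
Qed.

(** * Holomorphic functions and Cauchy's formula *)

(** Complex differentiability at [z], tested on differentiable paths: in this
    form it is stable under algebraic operations by the rules for paths. *)
Definition is_path_derive (G : C -> C) (z l : C) : Prop :=
  forall (p : R -> C) (t : R) (d : C),
    p t = z -> is_cderive p t d -> is_cderive (fun s => G (p s)) t (l * d)%C.

Definition holo (E : C -> Prop) (G G' : C -> C) : Prop :=
  forall z, E z -> is_path_derive G z (G' z) /\ ccontinuous G z /\ ccontinuous G' z.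

Lemma holo_id (E : C -> Prop) : holo E (fun z => z) (fun _ => 1%C).
Proof.
intros z _; split; [ | split ].
- intros p t d _ Hp; eapply is_cderive_eq; [ exact Hp | ring ].
- split; [ apply continuous_fst | apply continuous_snd ].
- apply ccontinuous_const.
Qed.

Lemma holo_const (E : C -> Prop) (c : C) : holo E (fun _ => c) (fun _ => 0%C).
Proof.
intros z _; split; [ | split ]; try apply ccontinuous_const.
intros p t d _ Hp; eapply is_cderive_eq; [ apply is_cderive_const | ring ].
Qed.

Lemma holo_minus (E : C -> Prop) (F F' G G' : C -> C) :
  holo E F F' -> holo E G G' ->
  holo E (fun z => F z - G z)%C (fun z => F' z - G' z)%C.
Proof.
intros HF HG z Ez; destruct (HF z Ez) as (F1 & F2 & F3), (HG z Ez) as (G1 & G2 & G3).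
split; [ | split; now apply ccontinuous_minus ].
intros p t d Hz Hp.
eapply is_cderive_eq;
  [ exact (is_cderive_minus _ _ _ _ _ (F1 p t d Hz Hp) (G1 p t d Hz Hp)) | ring ].
Qed.

Lemma holo_mult (E : C -> Prop) (F F' G G' : C -> C) :
  holo E F F' -> holo E G G' ->
  holo E (fun z => F z * G z)%C (fun z => F' z * G z + F z * G' z)%C.
Proof.
intros HF HG z Ez; destruct (HF z Ez) as (F1 & F2 & F3), (HG z Ez) as (G1 & G2 & G3).
split; [ | split; [ now apply ccontinuous_mult
                  | apply ccontinuous_plus; now apply ccontinuous_mult ] ].
intros p t d Hz Hp.
eapply is_cderive_eq;
  [ exact (is_cderive_mult _ _ _ _ _ (F1 p t d Hz Hp) (G1 p t d Hz Hp)) | ].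
cbv beta; rewrite Hz; ring.
Qed.

Lemma holo_inv (E : C -> Prop) (G G' : C -> C) :
  (forall z, E z -> G z <> 0%C) -> holo E G G' ->
  holo E (fun z => / G z)%C (fun z => 0 - G' z * (/ G z * / G z))%C.
Proof.
intros N HG z Ez; destruct (HG z Ez) as (G1 & G2 & G3); specialize (N z Ez).
assert (I := ccontinuous_inv _ _ N G2).
split; [ | split; [ exact I | ] ].
- intros p t d Hz Hp.
  assert (Np : G (p t) <> 0%C) by now rewrite Hz.
  eapply is_cderive_eq; [ exact (is_cderive_inv _ _ _ Np (G1 p t d Hz Hp)) | ].
  cbv beta; rewrite Hz; ring.
- apply ccontinuous_minus; [ apply ccontinuous_const | ].
  apply ccontinuous_mult; [ exact G3 | now apply ccontinuous_mult ].
Qed.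

Lemma holo_incl (E E' : C -> Prop) (G G' : C -> C) :
  (forall z, E' z -> E z) -> holo E G G' -> holo E' G G'.
Proof. intros I HG z Ez; exact (HG z (I z Ez)). Qed.

(** Shrinking the closed curve [w] to the point [p] along segments does not
    change the integral of [G (w) dw / (w - p)]: its derivative in the homotopy
    parameter is the integral of a derivative along a closed curve. *)
Lemma star_integral_Re (E : C -> Prop) (G G' : C -> C) (w w' k : R -> C) (p : C)
    (a b d : R) :
  0 < d -> holo E G G' ->
  (forall t, is_cderive w t (w' t)) -> (forall t, ccontinuous w' t) ->
  (forall t, ccontinuous k t) -> (forall t, k t * (w t - p) = w' t)%C ->
  w a = w b ->
  (forall l t, - d < l < 1 + d -> E (p + RtoC l * (w t - p))%C) ->
  RInt (fun t => Re (G (w t) * k t)%C) a b = RInt (fun t => Re (G p * k t)%C) a b.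
Proof.
intros Hd HG Dw Cw' Ck Ek Ew HE.
pose (g := fun l t => (p + RtoC l * (w t - p))%C).
pose (f := fun l t => Re (G (g l t) * k t)%C).
pose (df := fun l t => Re (G' (g l t) * w' t)%C).
assert (Cw : forall t, ccontinuous w t)
  by (intros t; exact (is_cderive_ccontinuous _ _ _ (Dw t))).
assert (Dgl : forall l t, is_cderive (fun l => g l t) l (w t - p)%C).
{ intros l t; eapply is_cderive_eq.
  - apply is_cderive_plus; [ apply is_cderive_const | ].
    apply is_cderive_mult; [ | apply is_cderive_const ].
    exact (is_cderive_RtoC (fun l => l) l 1 (is_derive_id (K := R_AbsRing) l)).
  - cbv beta; ring. }
assert (Dgt : forall l t, is_cderive (fun t => g l t) t (RtoC l * w' t)%C).
{ intros l t; eapply is_cderive_eq.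
  - apply is_cderive_plus; [ apply is_cderive_const | ].
    apply is_cderive_mult; [ apply is_cderive_const | ].
    apply is_cderive_minus; [ apply Dw | apply is_cderive_const ].
  - cbv beta; ring. }
assert (Df : forall l t, - d < l < 1 + d -> is_derive (fun l => f l t) l (df l t)).
{ intros l t Hl; destruct (HG _ (HE l t Hl)) as (G1 & _ & _).
  assert (X := is_cderive_mult _ _ _ _ _ (G1 (fun l => g l t) l _ eq_refl (Dgl l t))
                 (is_cderive_const (k t) l)).
  destruct X as [X _]; eapply is_derive_eq; [ exact X | ].
  apply (f_equal Re); rewrite <- Ek; unfold g; ring. }
assert (Cf : forall l t, - d < l < 1 + d -> continuous (f l) t).
{ intros l t Hl; destruct (HG _ (HE l t Hl)) as (_ & G2 & _).
  apply (ccontinuous_mult (fun t => G (g l t)) k); [ | apply Ck ].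
  apply (ccontinuous_comp G (g l)); [ | exact G2 ].
  exact (is_cderive_ccontinuous _ _ _ (Dgt l t)). }
assert (Cdf : forall l t, - d < l < 1 + d ->
              continuous (fun q : R * R => df (fst q) (snd q)) (l, t)).
{ intros l t Hl; destruct (HG _ (HE l t Hl)) as (_ & _ & G3).
  assert (Cs : continuous (fun q : R * R => snd q) (l, t)) by apply continuous_snd.
  assert (S : forall h : R -> C, ccontinuous h t ->
                ccontinuous (fun q : R * R => h (snd q)) (l, t)).
  { intros h [h1 h2]; split.
    - exact (continuous_comp (fun q : R * R => snd q) (fun t => Re (h t)) (l, t) Cs h1).
    - exact (continuous_comp (fun q : R * R => snd q) (fun t => Im (h t)) (l, t) Cs h2). }
  apply (ccontinuous_mult (fun q : R * R => G' (g (fst q) (snd q)))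
           (fun q : R * R => w' (snd q))); [ | apply S, Cw' ].
  apply (ccontinuous_comp G' (fun q : R * R => g (fst q) (snd q))); [ | exact G3 ].
  apply ccontinuous_plus; [ apply ccontinuous_const | ].
  apply ccontinuous_mult; [ apply ccontinuous_RtoC, continuous_fst | ].
  apply ccontinuous_minus; [ apply S, Cw | apply ccontinuous_const ]. }
assert (Cdft : forall l t, - d < l < 1 + d -> continuous (df l) t).
{ intros l t Hl; destruct (HG _ (HE l t Hl)) as (_ & _ & G3).
  apply (ccontinuous_mult (fun t => G' (g l t)) w'); [ | apply Cw' ].
  apply (ccontinuous_comp G' (g l)); [ | exact G3 ].
  exact (is_cderive_ccontinuous _ _ _ (Dgt l t)). }
assert (Z : forall l, - d < l < 1 + d -> RInt (df l) a b = 0).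
(* For [l <> 0] an antiderivative of [df l] is the real part of [G (g l t) / l]. It degenerates at
   [l = 0], where [df] reduces to the real part of [G' p * w' t] and [G' p * w t] takes its
   place. *)
{ intros l Hl; destruct (Req_dec l 0) as [->|Nl].
  - transitivity (minus (Re (G' p * w b)%C) (Re (G' p * w a)%C)).
    + apply is_RInt_unique, (is_RInt_derive (V := R_CompleteNormedModule)
        (fun t => Re (G' p * w t)%C)); [ intros t _ | intros t _; now apply Cdft ].
      assert (X := is_cderive_mult _ _ _ _ _ (is_cderive_const (G' p) t) (Dw t)).
      destruct X as [X _]; eapply is_derive_eq; [ exact X | ].
      unfold df, g; apply (f_equal Re); cbv beta.
      replace (p + 0 * (w t - p))%C with p by ring; ring.
    + rewrite Ew; apply (minus_eq_zero (G := R_AbelianGroup)).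
  - transitivity (minus (Re (RtoC (/ l) * G (g l b))%C) (Re (RtoC (/ l) * G (g l a))%C)).
    + apply is_RInt_unique, (is_RInt_derive (V := R_CompleteNormedModule)
        (fun t => Re (RtoC (/ l) * G (g l t))%C));
        [ intros t _ | intros t _; now apply Cdft ].
      destruct (HG _ (HE l t Hl)) as (G1 & _ & _).
      assert (X := is_cderive_mult _ _ _ _ _ (is_cderive_const (RtoC (/ l)) t)
                     (G1 (g l) t _ eq_refl (Dgt l t))).
      destruct X as [X _]; eapply is_derive_eq; [ exact X | ].
      apply (f_equal Re); unfold g.
      rewrite RtoC_inv by exact Nl; field; intros X0; apply Nl; now apply RtoC_inj.
    + unfold g; rewrite Ew; apply (minus_eq_zero (G := R_AbelianGroup)). }
assert (K : RInt (f 0) a b = RInt (f 1) a b).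
{ apply (eq_is_derive (V := R_NormedModule) (fun l => RInt (f l) a b)); [ | lra ].
  intros l Hl; assert (Hl' : - d < l < 1 + d) by lra.
  (* The margin [d] puts 0 and 1 in the interior of the range of [l], so that the derivative is
     two-sided at both ends of the homotopy. *)
  assert (L : locally l (fun u => - d < u < 1 + d)).
  { apply (locally_interval (fun u => - d < u < 1 + d) l (- d) (1 + d)); simpl; auto; lra. }
  eapply is_derive_eq.
  - apply (is_derive_RInt_param_explicit f df).
    + revert L; apply filter_imp; intros u Hu t; now apply Df.
    + revert L; apply filter_imp; intros u Hu t; now apply Cf.
    + intros t; now apply Cdf.
  - exact (Z l Hl'). }
transitivity (RInt (f 1) a b); [ | rewrite <- K ]; apply RInt_ext; intros t _;
  unfold f, g; f_equal; f_equal; f_equal; ring.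
Qed.

Definition CInt (f : R -> C) (a b : R) : C :=
  (RInt (fun t => Re (f t)) a b, RInt (fun t => Im (f t)) a b).

(** The imaginary part of an integral is the real part of the integral for [- i G], so the real
    statement is applied twice. *)
Lemma star_integral (E : C -> Prop) (G G' : C -> C) (w w' k : R -> C) (p : C)
    (a b d : R) :
  0 < d -> holo E G G' ->
  (forall t, is_cderive w t (w' t)) -> (forall t, ccontinuous w' t) ->
  (forall t, ccontinuous k t) -> (forall t, k t * (w t - p) = w' t)%C ->
  w a = w b ->
  (forall l t, - d < l < 1 + d -> E (p + RtoC l * (w t - p))%C) ->
  CInt (fun t => G (w t) * k t)%C a b = CInt (fun t => G p * k t)%C a b.
Proof.
intros Hd HG Dw Cw' Ck Ek Ew HE; unfold CInt; f_equal.
- now apply (star_integral_Re E G G' w w' k p a b d).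
- assert (X := star_integral_Re E (fun z => (0 - Ci) * G z)%C
    (fun z => 0 * G z + (0 - Ci) * G' z)%C w w' k p a b d Hd
    (holo_mult _ _ _ _ _ (holo_const E (0 - Ci)%C) HG) Dw Cw' Ck Ek Ew HE).
  transitivity (RInt (fun t => Re ((0 - Ci) * G (w t) * k t)%C) a b);
    [ | rewrite X ]; apply RInt_ext; intros t _; simpl; unfold Re, Im; ring.
Qed.

(** * Linearity of the complex integral *)

Lemma CInt_ext (f g : R -> C) (a b : R) :
  (forall t, f t = g t) -> CInt f a b = CInt g a b.
Proof.
intros E; unfold CInt; f_equal; apply RInt_ext; intros t _; now rewrite E.
Qed.

Lemma ex_RInt_Re (f : R -> C) (a b : R) :
  (forall t, ccontinuous f t) -> ex_RInt (fun t => Re (f t)) a b.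
Proof.
intros Cf; apply (ex_RInt_continuous (V := R_CompleteNormedModule)).
intros t _; apply Cf.
Qed.

Lemma ex_RInt_Im (f : R -> C) (a b : R) :
  (forall t, ccontinuous f t) -> ex_RInt (fun t => Im (f t)) a b.
Proof.
intros Cf; apply (ex_RInt_continuous (V := R_CompleteNormedModule)).
intros t _; apply Cf.
Qed.

Lemma CInt_plus (f g : R -> C) (a b : R) :
  (forall t, ccontinuous f t) -> (forall t, ccontinuous g t) ->
  CInt (fun t => f t + g t)%C a b = (CInt f a b + CInt g a b)%C.
Proof.
intros Cf Cg; unfold CInt, Cplus; simpl; f_equal.
- apply (RInt_plus (V := R_CompleteNormedModule)); now apply ex_RInt_Re.
- apply (RInt_plus (V := R_CompleteNormedModule)); now apply ex_RInt_Im.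
Qed.

Lemma CInt_scal (c : C) (f : R -> C) (a b : R) :
  (forall t, ccontinuous f t) -> CInt (fun t => c * f t)%C a b = (c * CInt f a b)%C.
Proof.
intros Cf; destruct c as [c1 c2]; unfold CInt, Cmult; simpl.
assert (Xr := ex_RInt_Re f a b Cf); assert (Xi := ex_RInt_Im f a b Cf).
f_equal.
- transitivity (RInt (fun t => minus (scal c1 (Re (f t))) (scal c2 (Im (f t)))) a b);
    [ reflexivity | ].
  rewrite (RInt_minus (V := R_CompleteNormedModule)),
    2 (RInt_scal (V := R_CompleteNormedModule)); auto;
    now apply (ex_RInt_scal (V := R_CompleteNormedModule)).
- transitivity (RInt (fun t => plus (scal c1 (Im (f t))) (scal c2 (Re (f t)))) a b);
    [ reflexivity | ].
  rewrite (RInt_plus (V := R_CompleteNormedModule)),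
    2 (RInt_scal (V := R_CompleteNormedModule)); auto;
    now apply (ex_RInt_scal (V := R_CompleteNormedModule)).
Qed.

Lemma CInt_const (c : C) (a b : R) : CInt (fun _ => c) a b = (RtoC (b - a) * c)%C.
Proof.
unfold CInt; rewrite !RInt_const; unfold scal, Cmult, Re, Im; simpl; unfold mult; simpl.
f_equal; ring.
Qed.

(** * Circles and Cauchy's integral formula on them *)

Definition cis (t : R) : C := (cos t, sin t).

Definition circle (c : C) (r : R) (t : R) : C := (c + RtoC r * cis t)%C.

Definition cdisc (c : C) (r : R) (z : C) : Prop := Cmod (z - c) < r.

Lemma Cmod_cis (t : R) : Cmod (cis t) = 1.
Proof.
unfold Cmod, cis; simpl.
replace (cos t * (cos t * 1) + sin t * (sin t * 1)) with (Rsqr (sin t) + Rsqr (cos t))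
  by (unfold Rsqr; ring).
rewrite sin2_cos2; apply sqrt_1.
Qed.

Lemma is_cderive_cis (t : R) : is_cderive cis t (Ci * cis t)%C.
Proof.
split; unfold cis; simpl.
- eapply is_derive_eq; [ apply is_derive_cos | ring ].
- eapply is_derive_eq; [ apply is_derive_sin | ring ].
Qed.

Lemma ccontinuous_cis (t : R) : ccontinuous cis t.
Proof. exact (is_cderive_ccontinuous _ _ _ (is_cderive_cis t)). Qed.

Lemma cis_2PI : cis (2 * PI) = cis 0.
Proof. unfold cis; now rewrite cos_2PI, sin_2PI, cos_0, sin_0. Qed.

Lemma is_cderive_circle (c : C) (r t : R) :
  is_cderive (circle c r) t (Ci * (RtoC r * cis t))%C.
Proof.
eapply is_cderive_eq.
- apply is_cderive_plus; [ apply is_cderive_const | ].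
  apply is_cderive_mult; [ apply is_cderive_const | apply is_cderive_cis ].
- cbv beta; ring.
Qed.

Lemma ccontinuous_circle (c : C) (r t : R) : ccontinuous (circle c r) t.
Proof. exact (is_cderive_ccontinuous _ _ _ (is_cderive_circle c r t)). Qed.

Lemma circle_2PI (c : C) (r : R) : circle c r 0 = circle c r (2 * PI).
Proof. unfold circle; now rewrite cis_2PI. Qed.

Lemma circle_minus_center (c : C) (r t : R) :
  (circle c r t - c)%C = (RtoC r * cis t)%C.
Proof. unfold circle; ring. Qed.

Lemma Cmod_circle (c : C) (r t : R) : 0 <= r -> Cmod (circle c r t - c) = r.
Proof.
intros Hr; rewrite circle_minus_center, Cmod_mult, Cmod_cis, Cmod_R, Rabs_pos_eq by exact Hr.
ring.
Qed.

Lemma circle_neq (c z : C) (r t : R) : cdisc c r z -> (circle c r t - z)%C <> 0%C.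
Proof.
unfold cdisc; intros Hz E.
assert (Hr : 0 <= r) by (pose proof (Cmod_ge_0 (z - c)); lra).
replace z with (circle c r t) in Hz
  by (rewrite <- (Cplus_0_l z), <- E; ring).
rewrite Cmod_circle in Hz by exact Hr; lra.
Qed.

(** The point is [c + (1 - l) (p - c) + l (w - c)], and [|1 - l| + |l|] stays below 3/2 for these
    [l]. This is why holomorphy is always asked on a disc of twice the radius of the circle. *)
Lemma star_in_disc (c p w : C) (r l : R) :
  0 < r -> Cmod (p - c) <= r -> Cmod (w - c) <= r -> - (1 / 4) < l < 1 + 1 / 4 ->
  cdisc c (2 * r) (p + RtoC l * (w - p))%C.
Proof.
intros Hr Hp Hw Hl; unfold cdisc.
replace (p + RtoC l * (w - p) - c)%C with (RtoC (1 - l) * (p - c) + RtoC l * (w - c))%C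
  by (rewrite RtoC_minus; ring).
eapply Rle_lt_trans; [ apply Cmod_triangle | ].
rewrite !Cmod_mult, !Cmod_R.
pose proof (Cmod_ge_0 (p - c)); pose proof (Cmod_ge_0 (w - c)).
unfold Rabs; destruct (Rcase_abs (1 - l)), (Rcase_abs l); nra.
Qed.

(** This is [dw / (i (w - z))] in the parameter of the circle; without the factor [i], Cauchy's
    formula has the real constant [2 PI]. *)
Definition cauchy_kernel (c : C) (r : R) (z : C) (t : R) : C :=
  (RtoC r * cis t * / (circle c r t - z))%C.

Lemma ccontinuous_cauchy_kernel (c : C) (r : R) (z : C) (t : R) :
  (circle c r t - z)%C <> 0%C -> ccontinuous (cauchy_kernel c r z) t.
Proof.
intros N; apply ccontinuous_mult.
- apply ccontinuous_mult; [ apply ccontinuous_const | apply ccontinuous_cis ].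
- apply ccontinuous_inv; [ exact N | ].
  apply ccontinuous_minus; [ apply ccontinuous_circle | apply ccontinuous_const ].
Qed.

Lemma Ci_neq_0 : Ci <> 0%C.
Proof. intros E; apply (f_equal snd) in E; simpl in E; lra. Qed.

Lemma Ci_sqr : (Ci * Ci = - (1))%C.
Proof. apply injective_projections; simpl; ring. Qed.

Lemma Cmult_Ci_inj (a b : C) : (Ci * a = Ci * b)%C -> a = b.
Proof.
intros E; replace a with (/ Ci * (Ci * a))%C by (field; apply Ci_neq_0).
rewrite E; field; apply Ci_neq_0.
Qed.

(** The change of variable [t -> - t] turns the kernel into the values on the
    unit circle of [1 / (1 - q e)], holomorphic inside. *)
Lemma CInt_cauchy_kernel (c : C) (r : R) (z : C) :
  0 < r -> cdisc c (r / 2) z ->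
  CInt (cauchy_kernel c r z) 0 (2 * PI) = RtoC (2 * PI).
Proof.
intros Hr Hz.
assert (Nr : RtoC r <> 0%C) by (intros E; apply RtoC_inj in E; lra).
(* On the circle [w - z = r e^(it) (1 - q e^(-it))]. As [|q| < 1/2], the function [1 / (1 - q e)] is
   holomorphic for [|e| < 2], twice the radius of the unit circle on which it is integrated. *)
pose (q := ((z - c) / RtoC r)%C).
assert (Hq : Cmod q < 1 / 2).
{ unfold q; rewrite Cmod_div, Cmod_R, Rabs_pos_eq by (exact Nr || lra).
  unfold cdisc in Hz; apply (Rmult_lt_reg_r r); [ exact Hr | ].
  unfold Rdiv; rewrite Rmult_assoc, Rinv_l by lra; lra. }
assert (Nq : forall e, cdisc 0 2 e -> (1 - q * e)%C <> 0%C).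
{ intros e He E; unfold cdisc in He.
  replace (e - 0)%C with e in He by ring.
  assert (X : Cmod (q * e) = 1).
  { replace (q * e)%C with (RtoC 1 - (1 - q * e))%C by ring.
    rewrite E; replace (RtoC 1 - 0)%C with (RtoC 1) by ring; apply Cmod_1. }
  rewrite Cmod_mult in X; pose proof (Cmod_ge_0 q); pose proof (Cmod_ge_0 e); nra. }
assert (HG := holo_inv (cdisc 0 2) _ _ Nq
  (holo_minus _ _ _ _ _ (holo_const _ 1%C)
     (holo_mult _ _ _ _ _ (holo_const _ q) (holo_id _)))).
assert (Dw : forall t, is_cderive (fun t => cis (- t)) t (- Ci * cis (- t))%C).
{ intros t; destruct (is_cderive_cis (- t)) as [D1 D2].
  assert (Dm : is_derive Ropp t (-1)) by (auto_derive; trivial; ring).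
  split.
  - eapply is_derive_eq; [ exact (is_derive_comp _ _ _ _ _ D1 Dm) | ].
    unfold scal; simpl; unfold mult; simpl; ring.
  - eapply is_derive_eq; [ exact (is_derive_comp _ _ _ _ _ D2 Dm) | ].
    unfold scal; simpl; unfold mult; simpl; ring. }
assert (Cw : forall t, ccontinuous (fun t => cis (- t)) t)
  by (intros t; exact (is_cderive_ccontinuous _ _ _ (Dw t))).
assert (S := star_integral (cdisc 0 2) _ _ (fun t => cis (- t))
  (fun t => - Ci * cis (- t))%C (fun _ => - Ci)%C 0%C 0 (2 * PI) (1 / 4) ltac:(lra) HG Dw).
assert (N : forall t, (circle c r t - z)%C <> 0%C).
{ intros t; apply circle_neq; unfold cdisc in *; lra. }
(* The factors [Ci] and [- Ci] multiply to 1; the second one is the weight [w' / w] of the curve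
   [cis (- t)], which [star_integral] contracts to 0. *)
transitivity (CInt (fun t => Ci * (/ (1 - q * cis (- t)) * - Ci))%C 0 (2 * PI)).
{ apply CInt_ext; intros t.
  assert (Ec : (cis t * cis (- t) = 1)%C).
  { unfold cis; rewrite cos_neg, sin_neg; pose proof (sin2_cos2 t) as X; unfold Rsqr in X.
    unfold Cmult; simpl; apply injective_projections; simpl; lra. }
  assert (Ne : (1 - q * cis (- t))%C <> 0%C).
  { apply Nq; unfold cdisc; replace (cis (- t) - 0)%C with (cis (- t)) by ring.
    rewrite Cmod_cis; lra. }
  replace (Ci * (/ (1 - q * cis (- t)) * - Ci))%C with (/ (1 - q * cis (- t)))%C.
  2: { replace (Ci * (/ (1 - q * cis (- t)) * - Ci))%C
         with (- (Ci * Ci) * / (1 - q * cis (- t)))%C by ring.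
       rewrite Ci_sqr; ring. }
  unfold cauchy_kernel.
  replace (circle c r t - z)%C with (RtoC r * cis t * (1 - q * cis (- t)))%C.
  - field; repeat split; [ exact Ne | | exact Nr ].
    intros E; rewrite E in Ec; apply (f_equal Re) in Ec; simpl in Ec; lra.
  - transitivity (RtoC r * cis t - RtoC r * q * (cis t * cis (- t)))%C; [ ring | ].
    rewrite Ec; unfold q, circle; field; exact Nr. }
rewrite CInt_scal.
2: { intros t; apply ccontinuous_mult; [ | apply ccontinuous_const ].
     apply ccontinuous_inv.
     - apply Nq; unfold cdisc; replace (cis (- t) - 0)%C with (cis (- t)) by ring.
       rewrite Cmod_cis; lra.
     - apply ccontinuous_minus; [ apply ccontinuous_const | ].
       apply ccontinuous_mult; [ apply ccontinuous_const | apply Cw ]. }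
cbv beta in S; rewrite S; clear S.
- rewrite CInt_const.
  replace (1 - q * 0)%C with (RtoC 1) by ring.
  replace (2 * PI - 0) with (2 * PI) by ring.
  transitivity (- (Ci * Ci) * RtoC (2 * PI))%C; [ field | rewrite Ci_sqr; ring ].
- intros t; apply ccontinuous_mult; [ apply ccontinuous_const | apply Cw ].
- intros t; apply ccontinuous_const.
- intros t; ring.
- rewrite Ropp_0; unfold cis; now rewrite cos_neg, sin_neg, cos_2PI, sin_2PI, cos_0, sin_0, Ropp_0.
- intros l t Hl; replace 2 with (2 * 1) by ring; apply star_in_disc; try lra.
  + replace (0 - 0)%C with (RtoC 0) by ring; rewrite Cmod_0; lra.
  + replace (cis (- t) - 0)%C with (cis (- t)) by ring; rewrite Cmod_cis; lra.
Qed.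

Lemma ccontinuous_holo_circle (E : C -> Prop) (G G' : C -> C) (c : C) (r t : R) :
  holo E G G' -> E (circle c r t) -> ccontinuous (fun t => G (circle c r t)) t.
Proof.
intros HG HE; destruct (HG _ HE) as (_ & G2 & _).
apply (ccontinuous_comp G (circle c r)); [ apply ccontinuous_circle | exact G2 ].
Qed.

Lemma circle_in_disc (c : C) (r t : R) : 0 < r -> cdisc c (2 * r) (circle c r t).
Proof. intros Hr; unfold cdisc; rewrite Cmod_circle; lra. Qed.

Lemma ccontinuous_Ci_circle' (r t : R) :
  ccontinuous (fun t => Ci * (RtoC r * cis t))%C t.
Proof.
apply ccontinuous_mult; [ apply ccontinuous_const | ].
apply ccontinuous_mult; [ apply ccontinuous_const | apply ccontinuous_cis ].
Qed.

(** Contracting the circle to [z] replaces [G (w)] by the constant [G z], leaving the integral of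
    the kernel alone. The factor [Ci] is inserted to make the weight equal to [w' / (w - z)], and is
    cancelled at the end. *)
Lemma cauchy_formula (G G' : C -> C) (c : C) (r : R) (z : C) :
  0 < r -> holo (cdisc c (2 * r)) G G' -> cdisc c (r / 2) z ->
  CInt (fun t => G (circle c r t) * cauchy_kernel c r z t)%C 0 (2 * PI)
  = (RtoC (2 * PI) * G z)%C.
Proof.
intros Hr HG Hz.
assert (Hz' : cdisc c r z) by (unfold cdisc in *; lra).
assert (N : forall t, (circle c r t - z)%C <> 0%C)
  by (intros t; now apply circle_neq).
assert (Ck : forall t, ccontinuous (cauchy_kernel c r z) t)
  by (intros t; now apply ccontinuous_cauchy_kernel).
assert (CG : forall t, ccontinuous (fun t => G (circle c r t)) t)
  by (intros t; apply (ccontinuous_holo_circle _ _ _ _ _ _ HG), circle_in_disc, Hr).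
apply Cmult_Ci_inj.
rewrite <- CInt_scal by (intros t; apply ccontinuous_mult; auto).
transitivity (CInt (fun t => G (circle c r t) * (Ci * cauchy_kernel c r z t))%C 0 (2 * PI)).
{ apply CInt_ext; intros t; ring. }
rewrite (star_integral (cdisc c (2 * r)) G G' (circle c r)
           (fun t => Ci * (RtoC r * cis t))%C _ z 0 (2 * PI) (1 / 4)); try lra.
- transitivity (CInt (fun t => (G z * Ci) * cauchy_kernel c r z t)%C 0 (2 * PI));
    [ apply CInt_ext; intros t; ring | ].
  rewrite CInt_scal, CInt_cauchy_kernel by assumption; ring.
- exact HG.
- intros t; apply is_cderive_circle.
- intros t; apply ccontinuous_Ci_circle'.
- intros t; apply ccontinuous_mult; [ apply ccontinuous_const | apply Ck ].
- intros t; unfold cauchy_kernel; field; apply N.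
- apply circle_2PI.
- intros l t Hl; apply star_in_disc; trivial.
  + apply Rlt_le, Hz'.
  + rewrite Cmod_circle; lra.
Qed.

(** The function [G (w) (w - c) / (w - z)] is now holomorphic in the whole disc and vanishes at [c].
    Contracting the circle to [c], with the constant weight [w' / (w - c) = i], gives 0. *)
Lemma cauchy_formula_outside (G G' : C -> C) (c : C) (r : R) (z : C) :
  0 < r -> holo (cdisc c (2 * r)) G G' -> ~ cdisc c (2 * r) z ->
  CInt (fun t => G (circle c r t) * cauchy_kernel c r z t)%C 0 (2 * PI) = 0%C.
Proof.
intros Hr HG Hz.
assert (Nz : forall w, cdisc c (2 * r) w -> (w - z)%C <> 0%C).
{ intros w Hw E; apply Hz; replace z with w; [ exact Hw | ].
  rewrite <- (Cplus_0_l z), <- E; ring. }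
assert (N : forall t, (circle c r t - z)%C <> 0%C)
  by (intros t; apply Nz, circle_in_disc, Hr).
assert (Ck : forall t, ccontinuous (cauchy_kernel c r z) t)
  by (intros t; now apply ccontinuous_cauchy_kernel).
assert (CG : forall t, ccontinuous (fun t => G (circle c r t)) t)
  by (intros t; apply (ccontinuous_holo_circle _ _ _ _ _ _ HG), circle_in_disc, Hr).
assert (HH := holo_mult _ _ _ _ _
  (holo_mult _ _ _ _ _ HG (holo_minus _ _ _ _ _ (holo_id _) (holo_const _ c)))
  (holo_inv _ _ _ Nz (holo_minus _ _ _ _ _ (holo_id _) (holo_const _ z)))).
apply Cmult_Ci_inj.
rewrite <- CInt_scal by (intros t; apply ccontinuous_mult; auto).
transitivity (CInt (fun t => (G (circle c r t) * (circle c r t - c)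
   * / (circle c r t - z)) * Ci)%C 0 (2 * PI)).
{ apply CInt_ext; intros t; unfold cauchy_kernel; rewrite circle_minus_center; ring. }
assert (S := star_integral _ _ _ (circle c r)
           (fun t => Ci * (RtoC r * cis t))%C (fun _ => Ci) c 0 (2 * PI) (1 / 4)
           ltac:(lra) HH).
cbv beta in S; rewrite S.
- rewrite CInt_const; ring.
- intros t; apply is_cderive_circle.
- intros t; apply ccontinuous_Ci_circle'.
- intros t; apply ccontinuous_const.
- intros t; rewrite circle_minus_center; ring.
- apply circle_2PI.
- intros l t Hl; apply star_in_disc; trivial.
  + replace (c - c)%C with (RtoC 0) by ring; rewrite Cmod_0; lra.
  + rewrite Cmod_circle; lra.
Qed.

(** * Even and odd parts of Cauchy integrals *)

Lemma is_derive_Re_CInt (f df : R -> R -> C) (a b x : R) :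
  locally x (fun u => forall t, is_cderive (fun u' => f u' t) u (df u t)) ->
  locally x (fun u => forall t, ccontinuous (f u) t) ->
  (forall t, ccontinuous (fun q : R * R => df (fst q) (snd q)) (x, t)) ->
  is_derive (fun u => Re (CInt (f u) a b)) x (Re (CInt (df x) a b)).
Proof.
intros Df Cf Cdf.
apply (is_derive_RInt_param_explicit (fun u t => Re (f u t)) (fun u t => Re (df u t))).
- revert Df; apply filter_imp; intros u Hu t; apply Hu.
- revert Cf; apply filter_imp; intros u Hu t; apply Hu.
- intros t; apply Cdf.
Qed.

Section AxialKernel.

Variables (h w : R -> C).
Hypotheses (Ch : forall t, ccontinuous h t) (Cw : forall t, ccontinuous w t).

(** With [z = al + i be] and [s = be^2], the factor [(w - al)^2 + s] is
    [(w - z) (w - conj z)], so that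
    [1 / (w - z) = (w - al) / ((w - al)^2 + s) + i be / ((w - al)^2 + s)]
    splits the Cauchy kernel into its even and odd parts in [be]. *)
Definition axial_den (al s t : R) : C := ((w t - RtoC al) * (w t - RtoC al) + RtoC s)%C.

Definition kernel_odd (n : nat) (al s t : R) : C :=
  (h t * (/ axial_den al s t) ^ S n)%C.
Definition kernel_even (n : nat) (al s t : R) : C :=
  (h t * (w t - RtoC al) * (/ axial_den al s t) ^ S n)%C.

Lemma ccontinuous_comp_real {T : UniformSpace} (g : R -> C) (t : T -> R) (x : T) :
  (forall t, ccontinuous g t) -> continuous t x -> ccontinuous (fun y => g (t y)) x.
Proof.
intros G Ct; destruct (G (t x)) as [G1 G2]; split.
- exact (continuous_comp t (fun t => Re (g t)) x Ct G1).
- exact (continuous_comp t (fun t => Im (g t)) x Ct G2).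
Qed.

Lemma ccontinuous_axial_den {T : UniformSpace} (al s t : T -> R) (x : T) :
  continuous al x -> continuous s x -> continuous t x ->
  ccontinuous (fun y => axial_den (al y) (s y) (t y)) x.
Proof.
intros Ca Cs Ct; apply ccontinuous_plus; [ apply ccontinuous_mult | ];
  try apply ccontinuous_minus; try (now apply ccontinuous_comp_real);
  now apply ccontinuous_RtoC.
Qed.

Lemma ccontinuous_kernel_odd {T : UniformSpace} (n : nat) (al s t : T -> R) (x : T) :
  continuous al x -> continuous s x -> continuous t x ->
  axial_den (al x) (s x) (t x) <> 0%C ->
  ccontinuous (fun y => kernel_odd n (al y) (s y) (t y)) x.
Proof.
intros Ca Cs Ct N; apply ccontinuous_mult; [ now apply ccontinuous_comp_real | ].
apply ccontinuous_pow, ccontinuous_inv; [ exact N | now apply ccontinuous_axial_den ].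
Qed.

Lemma ccontinuous_kernel_even {T : UniformSpace} (n : nat) (al s t : T -> R) (x : T) :
  continuous al x -> continuous s x -> continuous t x ->
  axial_den (al x) (s x) (t x) <> 0%C ->
  ccontinuous (fun y => kernel_even n (al y) (s y) (t y)) x.
Proof.
intros Ca Cs Ct N; apply ccontinuous_mult; [ apply ccontinuous_mult | ].
- now apply ccontinuous_comp_real.
- apply ccontinuous_minus; [ now apply ccontinuous_comp_real | now apply ccontinuous_RtoC ].
- apply ccontinuous_pow, ccontinuous_inv; [ exact N | now apply ccontinuous_axial_den ].
Qed.

Lemma is_cderive_RtoC_id (x : R) : is_cderive RtoC x 1%C.
Proof. exact (is_cderive_RtoC (fun l => l) x 1 (is_derive_id (K := R_AbsRing) x)). Qed.

Lemma is_cderive_axial_den_s (al s t : R) :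
  is_cderive (fun s => axial_den al s t) s 1%C.
Proof.
eapply is_cderive_eq.
- apply is_cderive_plus; [ apply is_cderive_const | apply is_cderive_RtoC_id ].
- ring.
Qed.

Lemma is_cderive_minus_al (al t : R) :
  is_cderive (fun al => w t - RtoC al)%C al (- (1))%C.
Proof.
eapply is_cderive_eq.
- apply is_cderive_minus; [ apply is_cderive_const | apply is_cderive_RtoC_id ].
- ring.
Qed.

Lemma is_cderive_axial_den_al (al s t : R) :
  is_cderive (fun al => axial_den al s t) al (- (2) * (w t - RtoC al))%C.
Proof.
eapply is_cderive_eq.
- apply is_cderive_plus; [ | apply is_cderive_const ].
  apply is_cderive_mult; apply is_cderive_minus_al.
- cbv beta; ring.
Qed.

Lemma kernel_odd_ds (n : nat) (al s t : R) :
  axial_den al s t <> 0%C ->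
  is_cderive (fun s => kernel_odd n al s t) s
    (RtoC (- INR (S n)) * kernel_odd (S n) al s t)%C.
Proof.
intros N; eapply is_cderive_eq.
- apply is_cderive_mult; [ apply is_cderive_const | ].
  apply (is_cderive_pow (fun s => / axial_den al s t)%C).
  apply is_cderive_inv; [ exact N | apply is_cderive_axial_den_s ].
- unfold kernel_odd; rewrite !Cpow_S, RtoC_opp; ring.
Qed.

Lemma kernel_even_ds (n : nat) (al s t : R) :
  axial_den al s t <> 0%C ->
  is_cderive (fun s => kernel_even n al s t) s
    (RtoC (- INR (S n)) * kernel_even (S n) al s t)%C.
Proof.
intros N; eapply is_cderive_eq.
- apply is_cderive_mult; [ apply is_cderive_const | ].
  apply (is_cderive_pow (fun s => / axial_den al s t)%C).
  apply is_cderive_inv; [ exact N | apply is_cderive_axial_den_s ].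
- unfold kernel_even; rewrite !Cpow_S, RtoC_opp; ring.
Qed.

Lemma kernel_odd_dal (n : nat) (al s t : R) :
  axial_den al s t <> 0%C ->
  is_cderive (fun al => kernel_odd n al s t) al
    (RtoC (2 * INR (S n)) * kernel_even (S n) al s t)%C.
Proof.
intros N; eapply is_cderive_eq.
- apply is_cderive_mult; [ apply is_cderive_const | ].
  apply (is_cderive_pow (fun al => / axial_den al s t)%C).
  apply is_cderive_inv; [ exact N | apply is_cderive_axial_den_al ].
- unfold kernel_even; rewrite !Cpow_S, RtoC_mult; ring.
Qed.

(** Differentiation produces [(w - al)^2], which is neither of the two kinds of numerator; writing
    it as the denominator minus [s] brings it back to odd kernels and keeps the family closed. *)
Lemma kernel_even_dal (n : nat) (al s t : R) :
  axial_den al s t <> 0%C ->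
  is_cderive (fun al => kernel_even n al s t) al
    (RtoC (2 * INR (S n) - 1) * kernel_odd n al s t
     + RtoC (- (2 * INR (S n) * s)) * kernel_odd (S n) al s t)%C.
Proof.
intros N; eapply is_cderive_eq.
- apply is_cderive_mult.
  + apply is_cderive_mult; [ apply is_cderive_const | apply is_cderive_minus_al ].
  + apply (is_cderive_pow (fun al => / axial_den al s t)%C).
    apply is_cderive_inv; [ exact N | apply is_cderive_axial_den_al ].
- unfold kernel_odd; rewrite !Cpow_S, RtoC_minus, RtoC_opp, !RtoC_mult; cbv beta.
  set (P := (/ axial_den al s t)%C).
  assert (E : ((w t - RtoC al) * (w t - RtoC al) * P = 1 - RtoC s * P)%C).
  { unfold P; replace ((w t - RtoC al) * (w t - RtoC al))%C
      with (axial_den al s t - RtoC s)%C by (unfold axial_den; ring).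
    field; exact N. }
  transitivity (- (h t * (P * P ^ n))
    + 2 * RtoC (INR (S n)) * h t * P ^ n * P * ((w t - RtoC al) * (w t - RtoC al) * P))%C;
    [ ring | rewrite E; ring ].
Qed.

(** The real part is enough: the differentiation rules of the kernels have real coefficients, and
    Cauchy's formula at [be] and at [- be] recovers both components of [G] from the two real
    parts. *)
Definition axial_odd (n : nat) (al s : R) : R :=
  Re (CInt (kernel_odd n al s) 0 (2 * PI)).
Definition axial_even (n : nat) (al s : R) : R :=
  Re (CInt (kernel_even n al s) 0 (2 * PI)).

Variables (a0 s0 e : R).
Hypothesis Nden : forall al s t,
  Rabs (al - a0) < e -> Rabs (s - s0) < e -> axial_den al s t <> 0%C.

Lemma locally_Rabs (x0 x : R) : Rabs (x - x0) < e -> locally x (fun y => Rabs (y - x0) < e).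
Proof.
intros Hx; apply Rabs_def2 in Hx.
apply (locally_interval _ x (x0 - e) (x0 + e)); simpl; try lra.
intros y H1 H2; apply Rabs_def1; lra.
Qed.

Lemma ccontinuous_kernel_odd_t (n : nat) (al s t : R) :
  Rabs (al - a0) < e -> Rabs (s - s0) < e -> ccontinuous (kernel_odd n al s) t.
Proof.
intros Ha Hs; apply (ccontinuous_kernel_odd n (fun _ => al) (fun _ => s) (fun t => t));
  try apply continuous_const; [ apply continuous_id | now apply Nden ].
Qed.

Lemma ccontinuous_kernel_even_t (n : nat) (al s t : R) :
  Rabs (al - a0) < e -> Rabs (s - s0) < e -> ccontinuous (kernel_even n al s) t.
Proof.
intros Ha Hs; apply (ccontinuous_kernel_even n (fun _ => al) (fun _ => s) (fun t => t));
  try apply continuous_const; [ apply continuous_id | now apply Nden ].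
Qed.

Lemma Re_RtoC_mult (r : R) (z : C) : Re (RtoC r * z)%C = r * Re z.
Proof. simpl; unfold Re; ring. Qed.

Lemma axial_odd_ds (n : nat) (al s : R) :
  Rabs (al - a0) < e -> Rabs (s - s0) < e ->
  is_derive (fun s => axial_odd n al s) s (- INR (S n) * axial_odd (S n) al s).
Proof.
intros Ha Hs; eapply is_derive_eq.
- apply (is_derive_Re_CInt (fun s t => kernel_odd n al s t)
    (fun s t => RtoC (- INR (S n)) * kernel_odd (S n) al s t)%C).
  + generalize (locally_Rabs _ _ Hs); apply filter_imp; intros u Hu t.
    apply kernel_odd_ds; now apply Nden.
  + generalize (locally_Rabs _ _ Hs); apply filter_imp; intros u Hu t.
    now apply ccontinuous_kernel_odd_t.
  + intros t; apply ccontinuous_mult; [ apply ccontinuous_const | ].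
    apply (ccontinuous_kernel_odd (S n) (fun _ => al) (fun q : R * R => fst q) (fun q => snd q));
      [ apply continuous_const | apply continuous_fst | apply continuous_snd | now apply Nden ].
- rewrite CInt_scal by (intros t; now apply ccontinuous_kernel_odd_t).
  apply Re_RtoC_mult.
Qed.

Lemma axial_even_ds (n : nat) (al s : R) :
  Rabs (al - a0) < e -> Rabs (s - s0) < e ->
  is_derive (fun s => axial_even n al s) s (- INR (S n) * axial_even (S n) al s).
Proof.
intros Ha Hs; eapply is_derive_eq.
- apply (is_derive_Re_CInt (fun s t => kernel_even n al s t)
    (fun s t => RtoC (- INR (S n)) * kernel_even (S n) al s t)%C).
  + generalize (locally_Rabs _ _ Hs); apply filter_imp; intros u Hu t.
    apply kernel_even_ds; now apply Nden.
  + generalize (locally_Rabs _ _ Hs); apply filter_imp; intros u Hu t.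
    now apply ccontinuous_kernel_even_t.
  + intros t; apply ccontinuous_mult; [ apply ccontinuous_const | ].
    apply (ccontinuous_kernel_even (S n) (fun _ => al) (fun q : R * R => fst q) (fun q => snd q));
      [ apply continuous_const | apply continuous_fst | apply continuous_snd | now apply Nden ].
- rewrite CInt_scal by (intros t; now apply ccontinuous_kernel_even_t).
  apply Re_RtoC_mult.
Qed.

Lemma axial_odd_dal (n : nat) (al s : R) :
  Rabs (al - a0) < e -> Rabs (s - s0) < e ->
  is_derive (fun al => axial_odd n al s) al (2 * INR (S n) * axial_even (S n) al s).
Proof.
intros Ha Hs; eapply is_derive_eq.
- apply (is_derive_Re_CInt (fun al t => kernel_odd n al s t)
    (fun al t => RtoC (2 * INR (S n)) * kernel_even (S n) al s t)%C).
  + generalize (locally_Rabs _ _ Ha); apply filter_imp; intros u Hu t.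
    apply kernel_odd_dal; now apply Nden.
  + generalize (locally_Rabs _ _ Ha); apply filter_imp; intros u Hu t.
    now apply ccontinuous_kernel_odd_t.
  + intros t; apply ccontinuous_mult; [ apply ccontinuous_const | ].
    apply (ccontinuous_kernel_even (S n) (fun q : R * R => fst q) (fun _ => s) (fun q => snd q));
      [ apply continuous_fst | apply continuous_const | apply continuous_snd | now apply Nden ].
- rewrite CInt_scal by (intros t; now apply ccontinuous_kernel_even_t).
  apply Re_RtoC_mult.
Qed.

Lemma axial_even_dal (n : nat) (al s : R) :
  Rabs (al - a0) < e -> Rabs (s - s0) < e ->
  is_derive (fun al => axial_even n al s) al
    ((2 * INR (S n) - 1) * axial_odd n al s - 2 * INR (S n) * s * axial_odd (S n) al s).
Proof.
intros Ha Hs; eapply is_derive_eq.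
- apply (is_derive_Re_CInt (fun al t => kernel_even n al s t)
    (fun al t => RtoC (2 * INR (S n) - 1) * kernel_odd n al s t
                 + RtoC (- (2 * INR (S n) * s)) * kernel_odd (S n) al s t)%C).
  + generalize (locally_Rabs _ _ Ha); apply filter_imp; intros u Hu t.
    apply kernel_even_dal; now apply Nden.
  + generalize (locally_Rabs _ _ Ha); apply filter_imp; intros u Hu t.
    now apply ccontinuous_kernel_even_t.
  + intros t; apply ccontinuous_plus;
      (apply ccontinuous_mult; [ apply ccontinuous_const | ]).
    * apply (ccontinuous_kernel_odd n (fun q : R * R => fst q) (fun _ => s) (fun q => snd q));
      [ apply continuous_fst | apply continuous_const | apply continuous_snd | now apply Nden ].
    * apply (ccontinuous_kernel_odd (S n) (fun q : R * R => fst q) (fun _ => s) (fun q => snd q));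
      [ apply continuous_fst | apply continuous_const | apply continuous_snd | now apply Nden ].
- assert (C0 : forall m t, ccontinuous (kernel_odd m al s) t)
    by (intros m t; now apply ccontinuous_kernel_odd_t).
  assert (C1 : forall c m t, ccontinuous (fun t => c * kernel_odd m al s t)%C t)
    by (intros c m t; apply ccontinuous_mult; [ apply ccontinuous_const | apply C0 ]).
  rewrite (CInt_plus _ _ 0 (2 * PI) (C1 _ n) (C1 _ (S n))).
  rewrite (CInt_scal _ _ 0 (2 * PI) (C0 n)), (CInt_scal _ _ 0 (2 * PI) (C0 (S n))).
  match goal with |- Re (?x + ?y)%C = _ => change (Re (x + y)%C) with (Re x + Re y) end.
  rewrite !Re_RtoC_mult; unfold axial_odd; ring.
Qed.

End AxialKernel.

(** Stem functions [U (al, be^2) + i be W (al, be^2)] are studied through the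
    two sequences [U n], [W n], with [U = U 0] and [W = W 0]; the values
    [s < 0] are allowed, so that nothing singular happens on the real axis [s = 0]. *)
Definition axial_system (a0 s0 e : R) (U W : nat -> R -> R -> R) : Prop :=
  forall (n : nat) (al s : R), Rabs (al - a0) < e -> Rabs (s - s0) < e ->
    is_derive (fun s => W n al s) s (- INR (S n) * W (S n) al s) /\
    is_derive (fun s => U n al s) s (- INR (S n) * U (S n) al s) /\
    is_derive (fun al => W n al s) al (2 * INR (S n) * U (S n) al s) /\
    is_derive (fun al => U n al s) al
      ((2 * INR (S n) - 1) * W n al s - 2 * INR (S n) * s * W (S n) al s).

(** * Local representation of a holomorphic function by an axial system *)

Lemma open_contains_disc (D : C -> Prop) (z : C) :
  open D -> D z -> exists r, 0 < r /\ forall z', cdisc z r z' -> D z'.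
Proof.
intros OD Dz; destruct (OD z Dz) as [e He]; exists e; split; [ apply cond_pos | ].
intros z' Hz'; apply He; pose proof (Rmax_Cmod (z' - z)%C) as M; unfold cdisc in Hz'.
split; change (Rabs ((fst z' - fst z)) < e) || change (Rabs ((snd z' - snd z)) < e);
  (eapply Rle_lt_trans; [ | exact Hz' ]; eapply Rle_trans; [ | exact M ]);
  [ apply Rmax_l | apply Rmax_r ].
Qed.

Section LocalRepresentation.

Variables (G G' : C -> C) (c : C) (r m : R).
Hypotheses (Hr : 0 < r) (HG : holo (cdisc c (2 * r)) G G').

(** The part of the Cauchy integrand that does not depend on [z]; [m] is a normalization, later
    [1 / (2 PI)] on the real axis and [2 / (2 PI)] off it. *)
Definition cauchy_density (t : R) : C :=
  (RtoC m * (G (circle c r t) * (RtoC r * cis t)))%C.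

Lemma ccontinuous_cauchy_density (t : R) : ccontinuous cauchy_density t.
Proof.
apply ccontinuous_mult; [ apply ccontinuous_const | ].
apply ccontinuous_mult.
- apply (ccontinuous_holo_circle _ _ _ _ _ _ HG), circle_in_disc, Hr.
- apply ccontinuous_mult; [ apply ccontinuous_const | apply ccontinuous_cis ].
Qed.

Let h := cauchy_density.
Let w := circle c r.

Lemma axial_den_factor (al be t : R) :
  axial_den w al (be * be) t = ((w t - (al, be)) * (w t - (al, (- be)%R)))%C.
Proof.
unfold axial_den; apply injective_projections; simpl; ring.
Qed.

Lemma cauchy_integral_split (al be : R) :
  (forall t, axial_den w al (be * be) t <> 0%C) ->
  (RtoC m * CInt (fun t => G (w t) * cauchy_kernel c r (al, be) t) 0 (2 * PI)
  = CInt (kernel_even h w 0 al (be * be)) 0 (2 * PI)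
    + Ci * RtoC be * CInt (kernel_odd h w 0 al (be * be)) 0 (2 * PI))%C.
Proof.
intros N.
assert (Ne : forall t, (w t - (al, be))%C <> 0%C).
{ intros t E; apply (N t); rewrite axial_den_factor, E; ring. }
assert (Co : forall t, ccontinuous (kernel_odd h w 0 al (be * be)) t).
{ intros t; apply (ccontinuous_kernel_odd h w ccontinuous_cauchy_density
    (ccontinuous_circle c r) 0 (fun _ => al) (fun _ => be * be) (fun t => t));
    try apply continuous_const; [ apply continuous_id | apply N ]. }
assert (Ce : forall t, ccontinuous (kernel_even h w 0 al (be * be)) t).
{ intros t; apply (ccontinuous_kernel_even h w ccontinuous_cauchy_density
    (ccontinuous_circle c r) 0 (fun _ => al) (fun _ => be * be) (fun t => t));
    try apply continuous_const; [ apply continuous_id | apply N ]. }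
rewrite <- (CInt_scal _ _ 0 (2 * PI) Co), <- CInt_plus, <- CInt_scal.
- apply CInt_ext; intros t.
  unfold kernel_even, kernel_odd, h, cauchy_density, cauchy_kernel; fold w.
  rewrite !Cpow_1_r.
  assert (Nt := N t); rewrite axial_den_factor in *.
  assert (E : (w t - RtoC al + Ci * RtoC be)%C = (w t - (al, (- be)%R))%C)
    by (apply injective_projections; simpl; ring).
  transitivity (RtoC m * (G (w t) * (RtoC r * cis t)) * (w t - RtoC al + Ci * RtoC be)
                * / ((w t - (al, be)) * (w t - (al, (- be)%R))))%C; [ | ring ].
  rewrite E; field; split; [ | apply Ne ].
  intros E0; apply Nt; rewrite E0; ring.
- intros t; apply ccontinuous_mult.
  + apply (ccontinuous_holo_circle _ _ _ _ _ _ HG), circle_in_disc, Hr.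
  + now apply ccontinuous_cauchy_kernel.
- exact Ce.
- intros t; apply ccontinuous_mult; [ apply ccontinuous_const | apply Co ].
Qed.

Lemma axial_system_cauchy (a0 s0 e : R) :
  (forall al s t, Rabs (al - a0) < e -> Rabs (s - s0) < e -> axial_den w al s t <> 0%C) ->
  axial_system a0 s0 e (axial_even h w) (axial_odd h w).
Proof.
intros N n al s Ha Hs.
assert (Ch := ccontinuous_cauchy_density : forall t, ccontinuous h t).
assert (Cw := ccontinuous_circle c r : forall t, ccontinuous w t).
split; [ | split; [ | split ] ].
- now apply (axial_odd_ds h w Ch Cw a0 s0 e N).
- now apply (axial_even_ds h w Ch Cw a0 s0 e N).
- now apply (axial_odd_dal h w Ch Cw a0 s0 e N).
- now apply (axial_even_dal h w Ch Cw a0 s0 e N).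
Qed.

End LocalRepresentation.

(** On the real axis both [z] and [conj z] lie in the disc, and the symmetry of
    [G] identifies the real and imaginary parts of [G z]. *)
Lemma local_representation_real (D : C -> Prop) (G G' : C -> C) (a : R) :
  open D -> D (a, 0) -> holo D G G' ->
  (forall z, D z -> G (Cconj z) = Cconj (G z)) ->
  exists e U W, 0 < e /\ axial_system a 0 e U W /\
    forall al be, Rabs (al - a) < e -> Rabs (be * be - 0) < e ->
      D (al, be) /\ G (al, be) = (U 0%nat al (be * be), be * W 0%nat al (be * be)).
Proof.
intros OD Dz HG SG.
destruct (open_contains_disc D _ OD Dz) as (rho & Hrho & Drho).
pose (r := rho / 2); assert (Hr : 0 < r) by (unfold r; lra).
pose (c := (a, 0) : C).
assert (HG' : holo (cdisc c (2 * r)) G G').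
{ apply (holo_incl D); [ | exact HG ]; intros z Hz; apply Drho.
  replace rho with (2 * r) by (unfold r; field); exact Hz. }
(* A zero of the denominator would force [|w - al|^2 = |s| < r^2 / 32], against
   [|w - al| > 3 r / 4]; this covers negative [s] too. The same [e] gives
   [(al - a)^2 + be^2 < r^2 / 16 + r^2 / 32], so that [z] is within [r / 2] of the centre. *)
pose (e := Rmin (r / 4) (r * r / 32)).
assert (He1 : e <= r / 4) by apply Rmin_l.
assert (He2 : e <= r * r / 32) by apply Rmin_r.
assert (He : 0 < e) by (apply Rmin_glb_lt; nra).
pose (m := / (2 * PI)).
pose (h := cauchy_density G c r m); pose (w := circle c r).
assert (N : forall al s t, Rabs (al - a) < e -> Rabs (s - 0) < e ->
              axial_den w al s t <> 0%C).
{ intros al s t Ha Hs E.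
  assert (T : r <= Cmod (w t - RtoC al) + Rabs (al - a)).
  { rewrite <- (Cmod_circle c r t) at 1 by lra; fold w.
    replace (w t - c)%C with ((w t - RtoC al) + RtoC (al - a))%C
      by (apply injective_projections; simpl; ring).
    rewrite <- Cmod_R; apply Cmod_triangle. }
  assert (Q : Cmod (w t - RtoC al) * Cmod (w t - RtoC al) = Rabs (s - 0)).
  { rewrite <- Cmod_mult, <- Cmod_R.
    replace ((w t - RtoC al) * (w t - RtoC al))%C with (- RtoC (s - 0))%C.
    - apply Cmod_opp.
    - replace (- RtoC (s - 0))%C with (0 - RtoC s)%C
        by (apply injective_projections; simpl; ring).
      rewrite <- E; unfold axial_den; ring. }
  nra. }
assert (Dis : forall al be, Rabs (al - a) < e -> Rabs (be * be - 0) < e ->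
                cdisc c (r / 2) (al, be)).
{ intros al be Ha Hb; unfold cdisc; apply Rsqr_incrst_0; try apply Cmod_ge_0; try lra.
  unfold Cmod; rewrite Rsqr_sqrt by (apply Rplus_le_le_0_compat; apply pow2_ge_0).
  unfold Rsqr; simpl.
  rewrite Rminus_0_r, Rabs_pos_eq in Hb by apply Rle_0_sqr.
  assert ((al - a) * (al - a) <= e * e) by (apply Rabs_def2 in Ha; nra).
  nra. }
exists e, (axial_even h w), (axial_odd h w); split; [ exact He | split ].
{ exact (axial_system_cauchy G G' c r m Hr HG' a 0 e N). }
intros al be Ha Hb.
assert (Hb' : Rabs (- be * - be - 0) < e) by (now replace (- be * - be) with (be * be) by ring).
assert (Dab : D (al, be)).
{ apply Drho; specialize (Dis al be Ha Hb); unfold cdisc in *; unfold r in Dis; fold c; lra. }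
split; [ exact Dab | ].
(* The formulas at [be] and [- be] contain the same two integrals, the odd one with opposite signs;
   their sum and difference separate them. *)
assert (X1 := cauchy_integral_split G G' c r m Hr HG' al be (fun t => N al _ t Ha Hb)).
assert (X2 := cauchy_integral_split G G' c r m Hr HG' al (- be) (fun t => N al _ t Ha Hb')).
rewrite (cauchy_formula G G' c r _ Hr HG' (Dis al be Ha Hb)) in X1.
rewrite (cauchy_formula G G' c r _ Hr HG' (Dis al (- be) Ha Hb')) in X2.
replace (- be * - be) with (be * be) in X2 by ring.
assert (S := SG _ Dab); change (Cconj (al, be)) with ((al, (- be)%R) : C) in S.
rewrite S in X2; clear S.
fold h w in X1, X2; unfold axial_even, axial_odd.
destruct (G (al, be)) as [u v].
destruct (CInt (kernel_even h w 0 al (be * be)) 0 (2 * PI)) as [e1 e2].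
destruct (CInt (kernel_odd h w 0 al (be * be)) 0 (2 * PI)) as [o1 o2].
assert (M : m * (2 * PI) = 1) by (unfold m; field; pose proof PI_RGT_0; lra).
assert (Y1 := f_equal Re X1); assert (Y2 := f_equal Im X1).
assert (Y3 := f_equal Re X2); assert (Y4 := f_equal Im X2).
simpl in *; ring_simplify in Y1; ring_simplify in Y2;
  ring_simplify in Y3; ring_simplify in Y4.
apply injective_projections; simpl.
- transitivity (m * (2 * PI) * u); [ rewrite M; ring | lra ].
- transitivity (m * (2 * PI) * v); [ rewrite M; ring | lra ].
Qed.

(** Off the real axis [conj z] lies outside the disc, where the Cauchy integral
    vanishes. *)
Lemma local_representation_upper (D : C -> Prop) (G G' : C -> C) (a b : R) :
  open D -> 0 < b -> D (a, b) -> holo D G G' ->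
  exists e U W, 0 < e /\ axial_system a (b * b) e U W /\
    forall al be, 0 <= be -> Rabs (al - a) < e -> Rabs (be * be - b * b) < e ->
      D (al, be) /\ G (al, be) = (U 0%nat al (be * be), be * W 0%nat al (be * be)).
Proof.
intros OD Hb0 Dz HG.
destruct (open_contains_disc D _ OD Dz) as (rho & Hrho & Drho).
(* The disc of radius [2 r] must lie in [D] and, since [2 r <= b], in the upper half-plane: then no
   point [(al, - be)] with [be >= 0] belongs to it. *)
pose (r := Rmin rho b / 2).
assert (Hr1 : 2 * r <= rho) by (unfold r; pose proof (Rmin_l rho b); lra).
assert (Hr2 : 2 * r <= b) by (unfold r; pose proof (Rmin_r rho b); lra).
assert (Hr : 0 < r) by (unfold r; pose proof (Rmin_glb_lt _ _ _ Hrho Hb0); lra).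
pose (c := (a, b) : C).
assert (HG' : holo (cdisc c (2 * r)) G G').
{ apply (holo_incl D); [ | exact HG ]; intros z Hz; apply Drho.
  unfold cdisc in *; fold c; lra. }
(* Since [be + b >= b], the bound [|be^2 - b^2| < r b / 4] yields [|be - b| < r / 4]; with
   [|al - a| < r / 4] the point stays within [r / 2] of the centre. *)
pose (e := Rmin (r / 4) (r * b / 4)).
assert (He1 : e <= r / 4) by apply Rmin_l.
assert (He2 : e <= r * b / 4) by apply Rmin_r.
assert (He : 0 < e) by (apply Rmin_glb_lt; nra).
(* The equation at [- be] has right-hand side 0 here, so the even and the odd term each carry half
   of [G]; the factor 2 compensates. *)
pose (m := 2 * / (2 * PI)).
pose (h := cauchy_density G c r m); pose (w := circle c r).
assert (Dis : forall al be, 0 <= be -> Rabs (al - a) < e -> Rabs (be * be - b * b) < e ->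
                cdisc c (r / 2) (al, be)).
{ intros al be Pb Ha Hb; unfold cdisc.
  replace ((al, be) - c)%C with (RtoC (al - a) + Ci * RtoC (be - b))%C
    by (apply injective_projections; simpl; ring).
  eapply Rle_lt_trans; [ apply Cmod_triangle | ].
  rewrite Cmod_mult, !Cmod_R.
  replace (Cmod Ci) with 1
    by (unfold Cmod; simpl; replace (0 * (0 * 1) + 1 * (1 * 1)) with 1 by ring; now rewrite sqrt_1).
  assert (Rabs (be - b) < r / 4); [ | lra ].
  apply Rabs_def2 in Hb; apply Rabs_def1; nra. }
assert (Out : forall al be, 0 <= be -> ~ cdisc c (2 * r) (al, (- be)%R)).
{ intros al be Pb Hd; unfold cdisc in Hd.
  pose proof (Rle_trans _ _ _ (Rmax_r _ _) (Rmax_Cmod ((al, (- be)%R) - c)%C)) as M.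
  assert (E : Rabs (snd ((al, (- be)%R) - c)%C) = be + b).
  { simpl; rewrite <- Rabs_Ropp, Rabs_pos_eq; lra. }
  rewrite E in M; lra. }
assert (N0 : forall al be t, 0 <= be -> Rabs (al - a) < e -> Rabs (be * be - b * b) < e ->
              axial_den w al (be * be) t <> 0%C).
{ intros al be t Pb Ha Hb; unfold w; rewrite axial_den_factor; apply Cmult_neq_0.
  - apply circle_neq; specialize (Dis al be Pb Ha Hb); unfold cdisc in *; lra.
  - intros E; apply (Out al be Pb).
    replace ((al, (- be)%R) : C) with (circle c r t); [ now apply circle_in_disc | ].
    rewrite <- (Cplus_0_l (al, (- be)%R)), <- E; ring. }
assert (N : forall al s t, Rabs (al - a) < e -> Rabs (s - b * b) < e ->
              axial_den w al s t <> 0%C).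
{ intros al s t Ha Hs.
  (* [e <= r b / 4 <= b^2 / 8], so [s] is the square of [sqrt s] and the factorization of the
     denominator applies. *)
  assert (Ps : 0 <= s) by (apply Rabs_def2 in Hs; nra).
  rewrite <- (sqrt_sqrt s Ps); apply N0; [ apply sqrt_pos | exact Ha | ].
  now rewrite (sqrt_sqrt s Ps). }
exists e, (axial_even h w), (axial_odd h w); split; [ exact He | split ].
{ exact (axial_system_cauchy G G' c r m Hr HG' a (b * b) e N). }
intros al be Pb Ha Hb.
assert (Hb' : Rabs (- be * - be - b * b) < e) by (now replace (- be * - be) with (be * be) by ring).
split.
{ apply Drho; specialize (Dis al be Pb Ha Hb); unfold cdisc in *; fold c; lra. }
assert (X1 := cauchy_integral_split G G' c r m Hr HG' al be (fun t => N al _ t Ha Hb)).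
assert (X2 := cauchy_integral_split G G' c r m Hr HG' al (- be) (fun t => N al _ t Ha Hb')).
rewrite (cauchy_formula G G' c r _ Hr HG' (Dis al be Pb Ha Hb)) in X1.
rewrite (cauchy_formula_outside G G' c r _ Hr HG' (Out al be Pb)) in X2.
replace (- be * - be) with (be * be) in X2 by ring.
fold h w in X1, X2; unfold axial_even, axial_odd.
destruct (G (al, be)) as [u v].
destruct (CInt (kernel_even h w 0 al (be * be)) 0 (2 * PI)) as [e1 e2].
destruct (CInt (kernel_odd h w 0 al (be * be)) 0 (2 * PI)) as [o1 o2].
assert (M : m * (2 * PI) = 2) by (unfold m; field; pose proof PI_RGT_0; lra).
assert (Y1 := f_equal Re X1); assert (Y2 := f_equal Im X1).
assert (Y3 := f_equal Re X2); assert (Y4 := f_equal Im X2).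
simpl in *; ring_simplify in Y1; ring_simplify in Y2;
  ring_simplify in Y3; ring_simplify in Y4.
assert (Mu : m * (2 * PI) * u = 2 * u) by (rewrite M; ring).
assert (Mv : m * (2 * PI) * v = 2 * v) by (rewrite M; ring).
apply injective_projections; simpl; lra.
Qed.

Lemma local_representation (D : C -> Prop) (G G' : C -> C) (a b : R) :
  open D -> 0 <= b -> D (a, b) -> holo D G G' ->
  (forall z, D z -> G (Cconj z) = Cconj (G z)) ->
  exists e U W, 0 < e /\ axial_system a (b * b) e U W /\
    forall al be, 0 <= be -> Rabs (al - a) < e -> Rabs (be * be - b * b) < e ->
      D (al, be) /\ G (al, be) = (U 0%nat al (be * be), be * W 0%nat al (be * be)).
Proof.
intros OD [Hb|<-] Dz HG SG; [ now apply (local_representation_upper D G G') | ].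
replace (0 * 0) with 0 by ring.
destruct (local_representation_real D G G' a OD Dz HG SG) as (e & U & W & He & HS & HR).
exists e, U, W; auto.
Qed.

(** * Quaternion-valued functions of a real variable *)

(** Indices above 3 repeat the last component, so that a quantifier over all [i : nat] ranges
    exactly over the four components. *)
Definition hcomp (i : nat) (q : H) : R :=
  match i with
  | 0 => fst (fst (fst q))
  | 1 => snd (fst (fst q))
  | 2 => snd (fst q)
  | _ => snd q
  end.

Definition is_hderive (g : R -> H) (t : R) (l : H) : Prop :=
  forall i, is_derive (fun s => hcomp i (g s)) t (hcomp i l).

Lemma is_hderive_eq (g : R -> H) (t : R) (l l' : H) :
  is_hderive g t l -> l = l' -> is_hderive g t l'.
Proof. now intros Hg <-. Qed.

Lemma is_hderive_DeriveH (g : R -> H) (t : R) (l : H) :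
  is_hderive g t l -> DeriveH g t = l.
Proof.
intros Hg; destruct l as [[[l0 l1] l2] l3]; apply H_eq; apply is_derive_unique.
- exact (Hg 0%nat).
- exact (Hg 1%nat).
- exact (Hg 2%nat).
- exact (Hg 3%nat).
Qed.

Lemma is_hderive_const (q : H) (t : R) : is_hderive (fun _ => q) t zero.
Proof.
intros i; destruct i as [|[|[|i]]];
  apply (is_derive_const (K := R_AbsRing) (V := R_NormedModule)).
Qed.

Lemma is_hderive_plus (f g : R -> H) (t : R) (l m : H) :
  is_hderive f t l -> is_hderive g t m ->
  is_hderive (fun s => plus (f s) (g s)) t (plus l m).
Proof.
intros Hf Hg i; specialize (Hf i); specialize (Hg i).
destruct i as [|[|[|i]]]; exact (is_derive_plus _ _ _ _ _ Hf Hg).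
Qed.

Lemma is_hderive_scal (r : R -> R) (f : R -> H) (t r' : R) (l : H) :
  is_derive r t r' -> is_hderive f t l ->
  is_hderive (fun s => scal (r s) (f s)) t (plus (scal r' (f t)) (scal (r t) l)).
Proof.
intros Hr Hf i; specialize (Hf i).
destruct i as [|[|[|i]]];
  exact (is_derive_mult (K := R_AbsRing) r _ t r' _ Hr Hf Rmult_comm).
Qed.

(** Each coordinate of [Hmult] is a sum of four products with signs; [e1], [e2], [e3] are those
    signs. *)
Lemma is_derive_sum4 (a b c d p q r s : R -> R) (t a' b' c' d' p' q' r' s' : R) :
  is_derive a t a' -> is_derive b t b' -> is_derive c t c' -> is_derive d t d' ->
  is_derive p t p' -> is_derive q t q' -> is_derive r t r' -> is_derive s t s' ->
  forall e1 e2 e3 : R,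
  is_derive (fun x => a x * p x + e1 * (b x * q x) + e2 * (c x * r x) + e3 * (d x * s x)) t
    ((a' * p t + a t * p') + e1 * (b' * q t + b t * q')
     + e2 * (c' * r t + c t * r') + e3 * (d' * s t + d t * s')).
Proof. intros; derive_known. Qed.

Lemma is_hderive_Hmult (f g : R -> H) (t : R) (l m : H) :
  is_hderive f t l -> is_hderive g t m ->
  is_hderive (fun s => Hmult (f s) (g s)) t (plus (Hmult l (g t)) (Hmult (f t) m)).
Proof.
intros Hf Hg.
assert (F0 := Hf 0%nat); assert (F1 := Hf 1%nat);
  assert (F2 := Hf 2%nat); assert (F3 := Hf 3%nat).
assert (G0 := Hg 0%nat); assert (G1 := Hg 1%nat);
  assert (G2 := Hg 2%nat); assert (G3 := Hg 3%nat).
clear Hf Hg.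
intros [|[|[|i]]].
- eapply is_derive_ext; [ | eapply is_derive_eq;
    [ exact (is_derive_sum4 _ _ _ _ _ _ _ _ _ _ _ _ _ _ _ _ _
              F0 F1 F2 F3 G0 G1 G2 G3 (-1) (-1) (-1)) | ] ].
  + intros s; cbv beta; destruct (f s) as [[[? ?] ?] ?], (g s) as [[[? ?] ?] ?]; unfold_H; ring.
  + cbv beta; destruct (f t) as [[[? ?] ?] ?], (g t) as [[[? ?] ?] ?], l as [[[? ?] ?] ?],
      m as [[[? ?] ?] ?]; unfold_H; ring.
- eapply is_derive_ext; [ | eapply is_derive_eq;
    [ exact (is_derive_sum4 _ _ _ _ _ _ _ _ _ _ _ _ _ _ _ _ _
              F0 F1 F2 F3 G1 G0 G3 G2 1 1 (-1)) | ] ].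
  + intros s; cbv beta; destruct (f s) as [[[? ?] ?] ?], (g s) as [[[? ?] ?] ?]; unfold_H; ring.
  + cbv beta; destruct (f t) as [[[? ?] ?] ?], (g t) as [[[? ?] ?] ?], l as [[[? ?] ?] ?],
      m as [[[? ?] ?] ?]; unfold_H; ring.
- eapply is_derive_ext; [ | eapply is_derive_eq;
    [ exact (is_derive_sum4 _ _ _ _ _ _ _ _ _ _ _ _ _ _ _ _ _
              F0 F1 F2 F3 G2 G3 G0 G1 (-1) 1 1) | ] ].
  + intros s; cbv beta; destruct (f s) as [[[? ?] ?] ?], (g s) as [[[? ?] ?] ?]; unfold_H; ring.
  + cbv beta; destruct (f t) as [[[? ?] ?] ?], (g t) as [[[? ?] ?] ?], l as [[[? ?] ?] ?],
      m as [[[? ?] ?] ?]; unfold_H; ring.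
- eapply is_derive_ext; [ | eapply is_derive_eq;
    [ exact (is_derive_sum4 _ _ _ _ _ _ _ _ _ _ _ _ _ _ _ _ _
              F0 F1 F2 F3 G3 G2 G1 G0 1 (-1) 1) | ] ].
  + intros s; cbv beta; destruct (f s) as [[[? ?] ?] ?], (g s) as [[[? ?] ?] ?]; unfold_H; ring.
  + cbv beta; destruct (f t) as [[[? ?] ?] ?], (g t) as [[[? ?] ?] ?], l as [[[? ?] ?] ?],
      m as [[[? ?] ?] ?]; unfold_H; ring.
Qed.

(** * Axial functions and their Laplacian *)

Definition hre (x : H) : R := fst (fst (fst x)).
Definition him (x : H) : H := (0, snd (fst (fst x)), snd (fst x), snd x).
Definition hdot (x y : H) : R :=
  snd (fst (fst x)) * snd (fst (fst y)) + snd (fst x) * snd (fst y) + snd x * snd y.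

Definition axial (P Q : R -> R -> H) (x : H) : H :=
  plus (P (hre x) (hdot x x)) (Hmult (him x) (Q (hre x) (hdot x x))).

Definition axial_nbhd (a s0 e : R) (x : H) : Prop :=
  Rabs (hre x - a) < e /\ Rabs (hdot x x - s0) < e.

Lemma hre_line (x d : H) (t : R) : hre (plus x (scal t d)) = hre x + t * hre d.
Proof. destruct x as [[[? ?] ?] ?], d as [[[? ?] ?] ?]; reflexivity. Qed.

Lemma hdot_line (x d : H) (t : R) :
  hdot (plus x (scal t d)) (plus x (scal t d)) = hdot x x + t * (2 * hdot x d) + t * t * hdot d d.
Proof. destruct x as [[[? ?] ?] ?], d as [[[? ?] ?] ?]; unfold_H; ring. Qed.

Lemma locally_axial_nbhd (a s0 e : R) (x d : H) :
  axial_nbhd a s0 e x -> locally 0 (fun t => axial_nbhd a s0 e (plus x (scal t d))).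
Proof.
intros [N1 N2].
assert (C1 : continuous (fun t : R => hre x + t * hre d) 0).
{ generalize (hre x), (hre d); intros p q.
  assert (X : ex_derive (fun t : R => p + t * q) 0) by (auto_derive; trivial).
  exact (ex_derive_continuous (K := R_AbsRing) (V := R_NormedModule) _ _ X). }
assert (C2 : continuous (fun t : R => hdot x x + t * (2 * hdot x d) + t * t * hdot d d) 0).
{ generalize (hdot x x), (hdot x d), (hdot d d); intros p q r.
  assert (X : ex_derive (fun t : R => p + t * (2 * q) + t * t * r) 0) by (auto_derive; trivial).
  exact (ex_derive_continuous (K := R_AbsRing) (V := R_NormedModule) _ _ X). }
assert (L1 : locally 0 (fun t : R => Rabs (hre x + t * hre d - a) < e)).
{ apply (C1 (fun y => Rabs (y - a) < e)), locally_Rabs.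
  now replace (hre x + 0 * hre d) with (hre x) by ring. }
assert (L2 : locally 0 (fun t : R =>
    Rabs (hdot x x + t * (2 * hdot x d) + t * t * hdot d d - s0) < e)).
{ apply (C2 (fun y => Rabs (y - s0) < e)), locally_Rabs.
  now replace (hdot x x + 0 * (2 * hdot x d) + 0 * 0 * hdot d d) with (hdot x x) by ring. }
generalize (filter_and _ _ L1 L2); apply filter_imp; intros t [T1 T2].
split; [ now rewrite hre_line | now rewrite hdot_line ].
Qed.

(** Agreement near [x] suffices, so [f] may itself be a [partialH] that is known only on the
    neighbourhood; second derivatives are computed in this way. *)
Lemma partialH_eq_near (a s0 e : R) (f g : H -> H) (d x l : H) :
  (forall y, axial_nbhd a s0 e y -> f y = g y) -> axial_nbhd a s0 e x ->
  is_hderive (fun t => g (plus x (scal t d))) 0 l -> partialH d f x = l.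
Proof.
intros E Nx Hg; rewrite <- (is_hderive_DeriveH _ _ _ Hg); unfold partialH, DeriveH.
apply H_eq; apply Derive_ext_loc; generalize (locally_axial_nbhd a s0 e x d Nx);
  apply filter_imp; intros t Nt; now rewrite (E _ Nt).
Qed.

Lemma is_hderive_him (x d : H) (t : R) :
  is_hderive (fun t => him (plus x (scal t d))) t (him d).
Proof.
destruct x as [[[x0 x1] x2] x3], d as [[[d0 d1] d2] d3].
intros [|[|[|i]]].
- change (is_derive (fun _ : R => 0) t 0); auto_derive; trivial; ring.
- change (is_derive (fun t : R => x1 + t * d1) t d1); auto_derive; trivial; ring.
- change (is_derive (fun t : R => x2 + t * d2) t d2); auto_derive; trivial; ring.
- change (is_derive (fun t : R => x3 + t * d3) t d3); auto_derive; trivial; ring.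
Qed.

Lemma is_derive_hdot_line (x d : H) :
  is_derive (fun t => hdot (plus x (scal t d)) d) 0 (hdot d d).
Proof.
destruct x as [[[x0 x1] x2] x3], d as [[[d0 d1] d2] d3].
change (is_derive (fun t : R => (x1 + t * d1) * d1 + (x2 + t * d2) * d2 + (x3 + t * d3) * d3) 0
          (d1 * d1 + d2 * d2 + d3 * d3)).
auto_derive; trivial; ring.
Qed.

Lemma plus_scal_0 (x d : H) : plus x (scal 0 d) = x.
Proof. destruct x as [[[? ?] ?] ?], d as [[[? ?] ?] ?]; unfold_H; apply H_eq; ring. Qed.

(** An imaginary direction leaves the first argument fixed, and the real direction the second one.
    Partial derivatives of [P] therefore suffice, with no joint differentiability. *)
Lemma is_hderive_imaginary_line (P : R -> R -> H) (x d l : H) :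
  hre d = 0 ->
  is_hderive (fun s => P (hre x) s) (hdot x x) l ->
  is_hderive (fun t => P (hre (plus x (scal t d)))
                         (hdot (plus x (scal t d)) (plus x (scal t d)))) 0
    (scal (2 * hdot x d) l).
Proof.
intros Hd HP i; specialize (HP i).
assert (S : is_derive (fun t : R => hdot x x + t * (2 * hdot x d) + t * t * hdot d d) 0
              (2 * hdot x d)).
{ generalize (hdot x x), (hdot x d), (hdot d d); intros p q r; auto_derive; trivial; ring. }
apply (is_derive_ext (fun t => hcomp i (P (hre x)
         (hdot x x + t * (2 * hdot x d) + t * t * hdot d d)))).
- intros t; rewrite hre_line, hdot_line, Hd; do 2 f_equal; ring.
- replace (hcomp i (scal (2 * hdot x d) l)) with (scal (2 * hdot x d) (hcomp i l))
    by (destruct i as [|[|[|i]]]; reflexivity).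
  apply (is_derive_comp (fun s => hcomp i (P (hre x) s))); [ | exact S ].
  now replace (hdot x x + 0 * (2 * hdot x d) + 0 * 0 * hdot d d) with (hdot x x) by ring.
Qed.

Lemma is_hderive_real_line (P : R -> R -> H) (x l : H) :
  is_hderive (fun al => P al (hdot x x)) (hre x) l ->
  is_hderive (fun t => P (hre (plus x (scal t H1)))
                         (hdot (plus x (scal t H1)) (plus x (scal t H1)))) 0 l.
Proof.
intros HP i; specialize (HP i).
assert (S : is_derive (fun t : R => hre x + t) 0 1)
  by (generalize (hre x); intros p; auto_derive; trivial; ring).
apply (is_derive_ext (fun t => hcomp i (P (hre x + t) (hdot x x)))).
- intros t; rewrite hre_line, hdot_line; unfold hre, hdot, H1; simpl; do 2 f_equal; ring.
- eapply is_derive_eq.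
  + apply (is_derive_comp (fun al => hcomp i (P al (hdot x x)))); [ | exact S ].
    rewrite Rplus_0_r; exact HP.
  + unfold scal; simpl; unfold mult; simpl; ring.
Qed.

Lemma axial_partial_real (P Q : R -> R -> H) (x p q : H) :
  is_hderive (fun al => P al (hdot x x)) (hre x) p ->
  is_hderive (fun al => Q al (hdot x x)) (hre x) q ->
  is_hderive (fun t => axial P Q (plus x (scal t H1))) 0 (plus p (Hmult (him x) q)).
Proof.
intros HP HQ; eapply is_hderive_eq.
- apply is_hderive_plus; [ exact (is_hderive_real_line P x p HP) | ].
  apply is_hderive_Hmult; [ apply is_hderive_him | exact (is_hderive_real_line Q x q HQ) ].
- cbv beta; rewrite plus_scal_0.
  destruct (Q (hre x) (hdot x x)) as [[[? ?] ?] ?], x as [[[? ?] ?] ?],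
    p as [[[? ?] ?] ?], q as [[[? ?] ?] ?].
  unfold_H; apply H_eq; ring.
Qed.

Lemma axial_partial_imaginary (P Q : R -> R -> H) (x d p q : H) :
  hre d = 0 ->
  is_hderive (fun s => P (hre x) s) (hdot x x) p ->
  is_hderive (fun s => Q (hre x) s) (hdot x x) q ->
  is_hderive (fun t => axial P Q (plus x (scal t d))) 0
    (plus (Hmult d (Q (hre x) (hdot x x)))
       (scal (2 * hdot x d) (plus p (Hmult (him x) q)))).
Proof.
intros Hd HP HQ; eapply is_hderive_eq.
- apply is_hderive_plus; [ exact (is_hderive_imaginary_line P x d p Hd HP) | ].
  apply is_hderive_Hmult;
    [ apply is_hderive_him | exact (is_hderive_imaginary_line Q x d q Hd HQ) ].
- cbv beta; rewrite plus_scal_0.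
  generalize (hdot x d); intros r.
  destruct (Q (hre x) (hdot x x)) as [[[? ?] ?] ?], x as [[[? ?] ?] ?],
    d as [[[d0 d1] d2] d3], p as [[[? ?] ?] ?], q as [[[? ?] ?] ?].
  change (d0 = 0) in Hd; subst d0.
  unfold_H; apply H_eq; ring.
Qed.

Lemma partialH_axial_imaginary_twice (P Q Ps Qs : R -> R -> H) (f : H -> H)
    (a s0 e : R) (x d p q : H) :
  (forall al s, Rabs (al - a) < e -> Rabs (s - s0) < e ->
     is_hderive (fun s => P al s) s (Ps al s) /\ is_hderive (fun s => Q al s) s (Qs al s)) ->
  (forall y, axial_nbhd a s0 e y -> f y = axial P Q y) -> axial_nbhd a s0 e x ->
  hre d = 0 -> hdot d d = 1 ->
  is_hderive (fun s => Ps (hre x) s) (hdot x x) p ->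
  is_hderive (fun s => Qs (hre x) s) (hdot x x) q ->
  partialH d (partialH d f) x =
    plus (scal 2 (plus (axial Ps Qs x)
                       (scal (2 * hdot x d) (Hmult d (Qs (hre x) (hdot x x))))))
         (scal (4 * (hdot x d * hdot x d)) (plus p (Hmult (him x) q))).
Proof.
intros HPQ Ef Nx Hd Ud Hp Hq.
(* The first derivative is again built from [Q] and an axial function, with the coefficient
   [2 * hdot y d], so the same rule differentiates it a second time. *)
apply (partialH_eq_near a s0 e _ (fun y =>
  plus (Hmult d (Q (hre y) (hdot y y))) (scal (2 * hdot y d) (axial Ps Qs y)))); [ | exact Nx | ].
- intros y Ny; apply (partialH_eq_near a s0 e f (axial P Q)); trivial.
  destruct Ny as [N1 N2]; destruct (HPQ _ _ N1 N2) as [HP HQ].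
  exact (axial_partial_imaginary P Q y d _ _ Hd HP HQ).
- destruct Nx as [N1 N2]; destruct (HPQ _ _ N1 N2) as [HP HQ].
  eapply is_hderive_eq.
  + apply is_hderive_plus.
    * apply is_hderive_Hmult; [ apply is_hderive_const | ].
      exact (is_hderive_imaginary_line Q x d _ Hd HQ).
    * apply is_hderive_scal;
        [ | exact (axial_partial_imaginary Ps Qs x d p q Hd Hp Hq) ].
      exact (is_derive_scal _ 0 2 _ (is_derive_hdot_line x d)).
  + cbv beta; rewrite plus_scal_0, Ud.
    unfold axial; set (r := hdot x d).
    destruct (Q (hre x) (hdot x x)) as [[[? ?] ?] ?], (Qs (hre x) (hdot x x)) as [[[? ?] ?] ?],
      (Ps (hre x) (hdot x x)) as [[[? ?] ?] ?].
    clearbody r; destruct x as [[[? ?] ?] ?],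
      d as [[[d0 d1] d2] d3], p as [[[? ?] ?] ?], q as [[[? ?] ?] ?].
    unfold_H; apply H_eq; ring.
Qed.

(** In the sum over [d = i, j, k], the second derivatives contribute [2] each to the coefficients of
    [Ps] and [Im x * Qs], which makes 6. The terms [4 <x, d> d Qs] add up to [4 Im x * Qs], whence
    10, and the squares [4 <x, d>^2] to [4 |Im x|^2]. *)
Lemma laplacian_axial (P Q Pa Qa Ps Qs : R -> R -> H) (f : H -> H)
    (a s0 e : R) (x paa qaa pss qss : H) :
  (forall al s, Rabs (al - a) < e -> Rabs (s - s0) < e ->
     is_hderive (fun al => P al s) al (Pa al s) /\ is_hderive (fun al => Q al s) al (Qa al s) /\
     is_hderive (fun s => P al s) s (Ps al s) /\ is_hderive (fun s => Q al s) s (Qs al s)) ->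
  (forall y, axial_nbhd a s0 e y -> f y = axial P Q y) -> axial_nbhd a s0 e x ->
  is_hderive (fun al => Pa al (hdot x x)) (hre x) paa ->
  is_hderive (fun al => Qa al (hdot x x)) (hre x) qaa ->
  is_hderive (fun s => Ps (hre x) s) (hdot x x) pss ->
  is_hderive (fun s => Qs (hre x) s) (hdot x x) qss ->
  laplacian f x =
    plus (plus paa (plus (scal 6 (Ps (hre x) (hdot x x))) (scal (4 * hdot x x) pss)))
      (Hmult (him x)
         (plus qaa (plus (scal 10 (Qs (hre x) (hdot x x))) (scal (4 * hdot x x) qss)))).
Proof.
intros HPQ Ef Nx Hpaa Hqaa Hpss Hqss.
assert (HPQs : forall al s, Rabs (al - a) < e -> Rabs (s - s0) < e ->
  is_hderive (fun s => P al s) s (Ps al s) /\ is_hderive (fun s => Q al s) s (Qs al s)).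
{ intros al s Ha Hs; destruct (HPQ al s Ha Hs) as (_ & _ & X & Y); now split. }
unfold laplacian.
assert (E0 : partialH H1 (partialH H1 f) x = plus paa (Hmult (him x) qaa)).
{ apply (partialH_eq_near a s0 e _ (axial Pa Qa)); [ | exact Nx | now apply axial_partial_real ].
  intros y Ny; apply (partialH_eq_near a s0 e f (axial P Q)); trivial.
  destruct Ny as [N1 N2]; destruct (HPQ _ _ N1 N2) as (HP & HQ & _).
  exact (axial_partial_real P Q y _ _ HP HQ). }
rewrite E0.
rewrite (partialH_axial_imaginary_twice P Q Ps Qs f a s0 e x Hi pss qss); trivial;
  [ | unfold_H; ring ].
rewrite (partialH_axial_imaginary_twice P Q Ps Qs f a s0 e x Hj pss qss); trivial;
  [ | unfold_H; ring ].
rewrite (partialH_axial_imaginary_twice P Q Ps Qs f a s0 e x Hk pss qss); trivial;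
  [ | unfold_H; ring ].
unfold axial; clear.
destruct (Qs (hre x) (hdot x x)) as [[[? ?] ?] ?], (Ps (hre x) (hdot x x)) as [[[? ?] ?] ?].
destruct x as [[[? ?] ?] ?], paa as [[[? ?] ?] ?], qaa as [[[? ?] ?] ?],
  pss as [[[? ?] ?] ?], qss as [[[? ?] ?] ?].
unfold_H; apply H_eq; ring.
Qed.

(** In the sum over [d = i, j, k], the terms [- d d Q] give [3 Q], and [- 2 <x, d> d] gives
    [- 2 Im x]; applied to [Im x * qs] the latter yields [2 |Im x|^2 qs], because
    [(Im x)^2 = - |Im x|^2]. *)
Lemma CRF_conj_axial (P Q : R -> R -> H) (f : H -> H)
    (a s0 e : R) (x pa qa ps qs : H) :
  (forall y, axial_nbhd a s0 e y -> f y = axial P Q y) -> axial_nbhd a s0 e x ->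
  is_hderive (fun al => P al (hdot x x)) (hre x) pa ->
  is_hderive (fun al => Q al (hdot x x)) (hre x) qa ->
  is_hderive (fun s => P (hre x) s) (hdot x x) ps ->
  is_hderive (fun s => Q (hre x) s) (hdot x x) qs ->
  CRF_conj f x =
    scal (/ 2)
      (plus (plus pa (plus (scal (2 * hdot x x) qs) (scal 3 (Q (hre x) (hdot x x)))))
        (Hmult (him x) (minus qa (scal 2 ps)))).
Proof.
intros Ef Nx Hpa Hqa Hps Hqs; unfold CRF_conj.
rewrite (partialH_eq_near a s0 e f _ H1 x _ Ef Nx (axial_partial_real P Q x pa qa Hpa Hqa)).
rewrite (partialH_eq_near a s0 e f _ Hi x _ Ef Nx
  (axial_partial_imaginary P Q x Hi ps qs eq_refl Hps Hqs)).
rewrite (partialH_eq_near a s0 e f _ Hj x _ Ef Nx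
  (axial_partial_imaginary P Q x Hj ps qs eq_refl Hps Hqs)).
rewrite (partialH_eq_near a s0 e f _ Hk x _ Ef Nx
  (axial_partial_imaginary P Q x Hk ps qs eq_refl Hps Hqs)).
clear.
destruct (Q (hre x) (hdot x x)) as [[[? ?] ?] ?].
destruct x as [[[? ?] ?] ?], pa as [[[? ?] ?] ?], qa as [[[? ?] ?] ?],
  ps as [[[? ?] ?] ?], qs as [[[? ?] ?] ?].
unfold_H; apply H_eq; field.
Qed.

(** * Components of a stem function *)

Lemma is_derive_hcomp (i : nat) (g : R -> H) (t : R) (l : H) :
  is_derive g t l -> is_derive (fun s => hcomp i (g s)) t (hcomp i l).
Proof.
intros Hg; assert (Ha := is_derive_fst _ _ _ Hg); assert (Hb := is_derive_fst _ _ _ Ha).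
destruct i as [|[|[|i]]].
- exact (is_derive_fst _ _ _ Hb).
- exact (is_derive_snd _ _ _ Hb).
- exact (is_derive_snd _ _ _ Ha).
- exact (is_derive_snd _ _ _ Hg).
Qed.

Lemma continuous_fst_comp {T U V : UniformSpace} (f : T -> U * V) (x : T) :
  continuous f x -> continuous (fun y => fst (f y)) x.
Proof.
intros Hf; apply (continuous_comp f fst x Hf); destruct (f x); apply continuous_fst.
Qed.

Lemma continuous_snd_comp {T U V : UniformSpace} (f : T -> U * V) (x : T) :
  continuous f x -> continuous (fun y => snd (f y)) x.
Proof.
intros Hf; apply (continuous_comp f snd x Hf); destruct (f x); apply continuous_snd.
Qed.

Lemma continuous_hcomp {T : UniformSpace} (i : nat) (f : T -> H) (x : T) :
  continuous f x -> continuous (fun y => hcomp i (f y)) x.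
Proof.
intros Hf; assert (Ha := continuous_fst_comp _ _ Hf); assert (Hb := continuous_fst_comp _ _ Ha).
destruct i as [|[|[|i]]].
- exact (continuous_fst_comp _ _ Hb).
- exact (continuous_snd_comp _ _ Hb).
- exact (continuous_snd_comp _ _ Ha).
- exact (continuous_snd_comp _ _ Hf).
Qed.

(** The path form of complex differentiability involves curves in arbitrary directions, hence a
    total differential; it comes from the continuity of one partial derivative. *)
Lemma filterdiff_of_partials (D : C -> Prop) (u ua : C -> R) (z : C) (ub : R) :
  open D -> D z ->
  (forall z, D z -> is_derive (fun a => u (a, Im z)) (Re z) (ua z)) ->
  is_derive (fun b => u (Re z, b)) (Im z) ub ->
  continuous ua z ->
  filterdiff (fun q : R * R => u (fst q, snd q)) (locally (Re z, Im z))
    (fun q : R * R => plus (scal (fst q) (ua z)) (scal (snd q) ub)).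
Proof.
intros OD Dz Hua Hub Cua; destruct z as [x y]; simpl in *.
apply (is_derive_filterdiff (fun x y => u (x, y)) x y (fun x y => ua (x, y)) ub).
- generalize (OD (x, y) Dz); apply filter_imp; intros [x' y'] Dz'; exact (Hua (x', y') Dz').
- exact Hub.
- apply (continuous_ext ua); [ intros [x' y']; reflexivity | exact Cua ].
Qed.

Lemma continuous_of_filterdiff (u : C -> R) (z : C) (l : R * R -> R) :
  filterdiff (fun q : R * R => u (fst q, snd q)) (locally (Re z, Im z)) l ->
  continuous u z.
Proof.
intros Hu; destruct z as [x y].
apply (continuous_ext (fun q : R * R => u (fst q, snd q)));
  [ intros [x' y']; reflexivity | ].
exact (filterdiff_continuous (K := R_AbsRing)
  (U := prod_NormedModule R_AbsRing R_NormedModule R_NormedModule) (V := R_NormedModule)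
  (fun q : R * R => u (fst q, snd q)) (x, y) (ex_intro _ l Hu)).
Qed.

Lemma is_derive_along_path (u : C -> R) (p : R -> C) (t : R) (d : C) (ua ub : R) :
  filterdiff (fun q : R * R => u (fst q, snd q)) (locally (Re (p t), Im (p t)))
    (fun q : R * R => plus (scal (fst q) ua) (scal (snd q) ub)) ->
  is_cderive p t d ->
  is_derive (fun s => u (p s)) t (ua * Re d + ub * Im d).
Proof.
intros Hu [P1 P2].
apply (is_derive_ext (fun s => u (Re (p s), Im (p s))));
  [ intros s; now destruct (p s) | ].
apply (filterdiff_ext_lin _ (fun y : R =>
         plus (scal (scal y (Re d)) ua) (scal (scal y (Im d)) ub))).
- exact (filterdiff_comp'_2 (K := R_AbsRing) (T := R_NormedModule) (U := R_NormedModule)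
    (V := R_NormedModule) (W := R_NormedModule) (fun s => Re (p s)) (fun s => Im (p s))
    (fun x y => u (x, y)) t _ _ (fun x y => plus (scal x ua) (scal y ub)) P1 P2 Hu).
- intros y; unfold scal, plus; simpl; unfold mult; simpl; ring.
Qed.

Lemma cauchy_riemann (F : C -> HC) (z : C) :
  dzbar F z = zero ->
  fst (d_alpha F z) = snd (d_beta F z) /\ snd (d_alpha F z) = opp (fst (d_beta F z)).
Proof.
unfold dzbar; destruct (d_alpha F z) as [[[[p0 p1] p2] p3] [[[q0 q1] q2] q3]],
  (d_beta F z) as [[[[r0 r1] r2] r3] [[[s0 s1] s2] s3]].
unfold_H; intros E.
assert (E1 := f_equal fst E); assert (E2 := f_equal snd E); simpl in E1, E2.
apply H_inj in E1; apply H_inj in E2; split; apply H_eq; lra.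
Qed.

Definition stem_comp (i : nat) (F : C -> HC) (z : C) : C :=
  (hcomp i (fst (F z)), hcomp i (snd (F z))).

Lemma hcomp_opp (i : nat) (q : H) : hcomp i (opp q) = - hcomp i q.
Proof. destruct i as [|[|[|i]]]; reflexivity. Qed.

(** Along a path with velocity [d] each component has derivative [ua * Re d + ub * Im d]; the
    Cauchy-Riemann equations combine the two into the complex product of the [al]-derivative and
    [d]. *)
Lemma holo_stem_comp (D : C -> Prop) (F : C -> HC) (i : nat) :
  open D -> holomorphic D F -> holo D (stem_comp i F) (stem_comp i (d_alpha F)).
Proof.
intros OD [CF HF] z Dz.
assert (Da : forall z, D z -> is_derive (fun a : R => F (a, Im z)) (Re z) (d_alpha F z))
  by (intros z' Dz'; apply ex_derive_DeriveHC, CF, Dz').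
assert (Db : is_derive (fun b : R => F (Re z, b)) (Im z) (d_beta F z))
  by (apply ex_derive_DeriveHC, CF, Dz).
destruct (CF z Dz) as (_ & _ & Ca & _).
assert (Cu := continuous_hcomp i _ _ (continuous_fst_comp (d_alpha F) z Ca)).
assert (Cv := continuous_hcomp i _ _ (continuous_snd_comp (d_alpha F) z Ca)).
assert (Fu := filterdiff_of_partials D (fun z => hcomp i (fst (F z)))
  (fun z => hcomp i (fst (d_alpha F z))) z _ OD Dz
  (fun z Dz => is_derive_hcomp i _ _ _ (is_derive_fst _ _ _ (Da z Dz)))
  (is_derive_hcomp i _ _ _ (is_derive_fst _ _ _ Db)) Cu).
assert (Fv := filterdiff_of_partials D (fun z => hcomp i (snd (F z)))
  (fun z => hcomp i (snd (d_alpha F z))) z _ OD Dz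
  (fun z Dz => is_derive_hcomp i _ _ _ (is_derive_snd _ _ _ (Da z Dz)))
  (is_derive_hcomp i _ _ _ (is_derive_snd _ _ _ Db)) Cv).
destruct (cauchy_riemann F z (HF z Dz)) as [CR1 CR2].
split; [ | split; split ].
- intros p t d <- Hp; split.
  + eapply is_derive_eq;
      [ exact (is_derive_along_path (fun z => hcomp i (fst (F z))) p t d _ _ Fu Hp) | ].
    unfold stem_comp; rewrite CR2, hcomp_opp; simpl; unfold Re, Im; ring.
  + eapply is_derive_eq;
      [ exact (is_derive_along_path (fun z => hcomp i (snd (F z))) p t d _ _ Fv Hp) | ].
    unfold stem_comp; rewrite CR1; simpl; unfold Re, Im; ring.
- exact (continuous_of_filterdiff _ _ _ Fu).
- exact (continuous_of_filterdiff _ _ _ Fv).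
- exact Cu.
- exact Cv.
Qed.

(** * Local form of slice-regular functions *)

Definition haxial_system (a s0 e : R) (A B : nat -> R -> R -> H) : Prop :=
  forall (n : nat) (al s : R), Rabs (al - a) < e -> Rabs (s - s0) < e ->
    is_hderive (fun s => B n al s) s (scal (- INR (S n)) (B (S n) al s)) /\
    is_hderive (fun s => A n al s) s (scal (- INR (S n)) (A (S n) al s)) /\
    is_hderive (fun al => B n al s) al (scal (2 * INR (S n)) (A (S n) al s)) /\
    is_hderive (fun al => A n al s) al
      (minus (scal (2 * INR (S n) - 1) (B n al s))
             (scal (2 * INR (S n) * s) (B (S n) al s))).

Lemma local_representation_H (D : C -> Prop) (F : C -> HC) (a b : R) :
  open D -> 0 <= b -> D (a, b) -> stem D F -> holomorphic D F ->
  exists e A B, 0 < e /\ haxial_system a (b * b) e A B /\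
    forall al be, 0 <= be -> Rabs (al - a) < e -> Rabs (be * be - b * b) < e ->
      D (al, be) /\
      F (al, be) = (A 0%nat al (be * be), scal be (B 0%nat al (be * be))).
Proof.
intros OD Hb Dz SF HF.
assert (L := fun i => local_representation D _ _ a b OD Hb Dz (holo_stem_comp D F i OD HF)).
assert (SG : forall i z, D z -> stem_comp i F (Cconj z) = Cconj (stem_comp i F z)).
{ intros i z Dz'; unfold stem_comp; rewrite (SF z Dz'); unfold HC_conj; simpl.
  now rewrite hcomp_opp. }
destruct (L 0%nat (SG _)) as (e0 & U0 & W0 & He0 & S0 & R0).
destruct (L 1%nat (SG _)) as (e1 & U1 & W1 & He1 & S1 & R1).
destruct (L 2%nat (SG _)) as (e2 & U2 & W2 & He2 & S2 & R2).
destruct (L 3%nat (SG _)) as (e3 & U3 & W3 & He3 & S3 & R3).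
clear L.
pose (e := Rmin (Rmin e0 e1) (Rmin e2 e3)).
assert (M1 := Rmin_l (Rmin e0 e1) (Rmin e2 e3)); assert (M2 := Rmin_r (Rmin e0 e1) (Rmin e2 e3)).
assert (M3 := Rmin_l e0 e1); assert (M4 := Rmin_r e0 e1).
assert (M5 := Rmin_l e2 e3); assert (M6 := Rmin_r e2 e3).
fold e in M1, M2.
exists e, (fun n al s => (U0 n al s, U1 n al s, U2 n al s, U3 n al s)),
  (fun n al s => (W0 n al s, W1 n al s, W2 n al s, W3 n al s)).
split; [ | split ].
- unfold e; repeat apply Rmin_glb_lt; assumption.
- intros n al s Ha Hs.
  destruct (S0 n al s ltac:(lra) ltac:(lra)) as (X01 & X02 & X03 & X04).
  destruct (S1 n al s ltac:(lra) ltac:(lra)) as (X11 & X12 & X13 & X14).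
  destruct (S2 n al s ltac:(lra) ltac:(lra)) as (X21 & X22 & X23 & X24).
  destruct (S3 n al s ltac:(lra) ltac:(lra)) as (X31 & X32 & X33 & X34).
  split; [ | split; [ | split ] ]; intros [|[|[|i]]]; assumption.
- intros al be Pb Ha Hs.
  destruct (R0 al be Pb ltac:(lra) ltac:(lra)) as [Dab E0].
  destruct (R1 al be Pb ltac:(lra) ltac:(lra)) as [_ E1].
  destruct (R2 al be Pb ltac:(lra) ltac:(lra)) as [_ E2].
  destruct (R3 al be Pb ltac:(lra) ltac:(lra)) as [_ E3].
  split; [ exact Dab | ].
  unfold stem_comp in E0, E1, E2, E3.
  destruct (F (al, be)) as [[[[p0 p1] p2] p3] [[[q0 q1] q2] q3]]; simpl in *.
  injection E0; injection E1; injection E2; injection E3; intros; subst; reflexivity.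
Qed.

Lemma sphere_decomposition (x : H) :
  exists J, sphereS J /\ x = slice_point (hre x) (sqrt (hdot x x)) J /\
    him x = scal (sqrt (hdot x x)) J.
Proof.
destruct x as [[[x0 x1] x2] x3].
assert (P : 0 <= hdot (x0, x1, x2, x3) (x0, x1, x2, x3)) by (unfold_H; nra).
set (s := hdot (x0, x1, x2, x3) (x0, x1, x2, x3)) in *.
assert (Es : s = x1 * x1 + x2 * x2 + x3 * x3) by reflexivity.
destruct P as [P|P].
- assert (Q := sqrt_lt_R0 s P); assert (QQ := sqrt_sqrt s (Rlt_le _ _ P)).
  set (r := sqrt s) in *; clearbody r s.
  exists (0, x1 / r, x2 / r, x3 / r); split; [ | split ].
  + apply (proj2 (sphereS_coord 0 (x1 / r) (x2 / r) (x3 / r))); split; trivial.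
    apply (Rmult_eq_reg_r s); [ | lra ].
    rewrite <- QQ at 1; field_simplify; lra.
  + unfold_H; apply H_eq; field; lra.
  + unfold_H; apply H_eq; field; lra.
(* At a real point every [J] works, and [Hi] is taken. *)
- rewrite <- P in *; clearbody s.
  assert (x1 = 0) by nra; assert (x2 = 0) by nra; assert (x3 = 0) by nra; subst.
  rewrite sqrt_0; exists Hi; split; [ apply sphereS_Hi | split ];
    unfold_H; apply H_eq; ring.
Qed.

(** With [be = |Im y|] and [Im y = be J], the term [J (be Q)] is [Im y * Q]: the choice of [J]
    disappears and only [be >= 0] is needed. *)
Lemma induces_axial (D : C -> Prop) (F : C -> HC) (f : H -> H) (a s0 e : R)
    (P Q : R -> R -> H) :
  induces D F f ->
  (forall al be, 0 <= be -> Rabs (al - a) < e -> Rabs (be * be - s0) < e ->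
     D (al, be) /\ F (al, be) = (P al (be * be), scal be (Q al (be * be)))) ->
  forall y, axial_nbhd a s0 e y -> f y = axial P Q y.
Proof.
intros IF HF y [N1 N2].
destruct (sphere_decomposition y) as (J & HJ & Ey & Ei).
assert (Py : 0 <= hdot y y) by (destruct y as [[[? ?] ?] ?]; unfold_H; nra).
destruct (HF (hre y) (sqrt (hdot y y)) (sqrt_pos _) N1) as [Dy Fy];
  [ now rewrite sqrt_sqrt | ].
rewrite Ey at 1; rewrite (IF _ _ _ Dy HJ), Fy, sqrt_sqrt by exact Py.
unfold axial; rewrite Ei; simpl; f_equal.
generalize (sqrt (hdot y y)); intros r.
destruct (Q (hre y) (hdot y y)) as [[[? ?] ?] ?], J as [[[? ?] ?] ?].
unfold_H; apply H_eq; ring.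
Qed.

Lemma dz_holomorphic (D : C -> Prop) (F : C -> HC) (z : C) :
  holomorphic D F -> D z -> dz F z = d_alpha F z.
Proof.
intros [_ HF] Dz; destruct (cauchy_riemann F z (HF z Dz)) as [CR1 CR2]; revert CR1 CR2.
unfold dz; destruct (d_alpha F z) as [[[[p0 p1] p2] p3] [[[q0 q1] q2] q3]],
  (d_beta F z) as [[[[r0 r1] r2] r3] [[[s0 s1] s2] s3]].
unfold_H; intros E1 E2; apply H_inj in E1; apply H_inj in E2.
apply f_equal2; apply H_eq; lra.
Qed.

(** For a holomorphic stem [dz] is the derivative in [al], so the two [al]-rules at [n = 0] give it,
    the factor [be] of the second component being constant. *)
Lemma dz_local_representation (D : C -> Prop) (F : C -> HC) (a s0 e : R)
    (A B : nat -> R -> R -> H) :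
  holomorphic D F -> haxial_system a s0 e A B ->
  (forall al be, 0 <= be -> Rabs (al - a) < e -> Rabs (be * be - s0) < e ->
     D (al, be) /\ F (al, be) = (A 0%nat al (be * be), scal be (B 0%nat al (be * be)))) ->
  forall al be, 0 <= be -> Rabs (al - a) < e -> Rabs (be * be - s0) < e ->
    D (al, be) /\
    dz F (al, be) =
      (minus (B 0%nat al (be * be)) (scal (2 * (be * be)) (B 1%nat al (be * be))),
       scal be (scal 2 (A 1%nat al (be * be)))).
Proof.
intros HF HS HR al be Pb Ha Hs.
destruct (HR al be Pb Ha Hs) as [Dab _]; split; [ exact Dab | ].
rewrite (dz_holomorphic D F _ HF Dab); unfold d_alpha; simpl.
rewrite (DeriveHC_ext_loc _
  (fun al => (A 0%nat al (be * be), scal be (B 0%nat al (be * be))))).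
- destruct (HS 0%nat al (be * be) Ha Hs) as (_ & _ & HB & HA).
  unfold DeriveHC; apply f_equal2; apply is_hderive_DeriveH.
  + eapply is_hderive_eq; [ exact HA | ].
    destruct (B 0%nat al (be * be)) as [[[? ?] ?] ?], (B 1%nat al (be * be)) as [[[? ?] ?] ?].
    unfold_H; apply H_eq; ring.
  + eapply is_hderive_eq.
    * apply is_hderive_scal; [ apply (is_derive_const (K := R_AbsRing) (V := R_NormedModule))
                             | exact HB ].
    * cbv beta.
      destruct (B 0%nat al (be * be)) as [[[? ?] ?] ?], (A 1%nat al (be * be)) as [[[? ?] ?] ?].
      unfold_H; apply H_eq; ring.
- generalize (locally_Rabs _ _ _ Ha); apply filter_imp; intros x Hx.
  now destruct (HR x be Pb Hx Hs).
Qed.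

(** * The identity for functions of axial form *)

Lemma is_hderive_scal_const (c : R) (f : R -> H) (t : R) (l : H) :
  is_hderive f t l -> is_hderive (fun s => scal c (f s)) t (scal c l).
Proof.
intros Hf; eapply is_hderive_eq.
- apply is_hderive_scal; [ apply (is_derive_const (K := R_AbsRing) (V := R_NormedModule))
                         | exact Hf ].
- cbv beta; destruct (f t) as [[[? ?] ?] ?], l as [[[? ?] ?] ?]; unfold_H; apply H_eq; ring.
Qed.

Lemma is_hderive_scal_id (f : R -> H) (t c : R) (l : H) :
  is_hderive f t l ->
  is_hderive (fun s => scal (c * s) (f s)) t (plus (scal c (f t)) (scal (c * t) l)).
Proof.
intros Hf; apply (is_hderive_scal (fun s => c * s)); [ auto_derive; trivial; ring | exact Hf ].
Qed.

Lemma is_hderive_minus (f g : R -> H) (t : R) (l m : H) :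
  is_hderive f t l -> is_hderive g t m ->
  is_hderive (fun s => minus (f s) (g s)) t (minus l m).
Proof.
intros Hf Hg i; specialize (Hf i); specialize (Hg i).
destruct i as [|[|[|i]]]; exact (is_derive_minus _ _ _ _ _ Hf Hg).
Qed.

(** Both sides come out as [-12 B 1 + 16 s B 2 - 16 Im x * A 2]. On the right, [A 3] and [B 3] occur
    with a factor [s] or [s^2] in the [al]-part and in the [s]-part of the Laplacian, and cancel. *)
Lemma CRF_conj_laplacian_axial (f f' : H -> H) (a s0 e : R) (A B : nat -> R -> R -> H) (x : H) :
  haxial_system a s0 e A B ->
  (forall y, axial_nbhd a s0 e y -> f y = axial (A 0%nat) (B 0%nat) y) ->
  (forall y, axial_nbhd a s0 e y ->
     f' y = axial (fun al s => minus (B 0%nat al s) (scal (2 * s) (B 1%nat al s)))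
                  (fun al s => scal 2 (A 1%nat al s)) y) ->
  axial_nbhd a s0 e x ->
  CRF_conj (laplacian f) x = laplacian f' x.
Proof.
intros HS Hf Hf' Nx.
(* The terms in [s A 2] and [s B 2] cancel, and the coefficients of [A 1] and [B 1] are [2 - 6] and
   [6 - 10]. The formula is needed on the whole neighbourhood because it is differentiated again. *)
assert (Lf : forall y, axial_nbhd a s0 e y -> laplacian f y =
  axial (fun al s => scal (-4) (A 1%nat al s)) (fun al s => scal (-4) (B 1%nat al s)) y).
{ intros y Ny; destruct (Ny) as [N1 N2].
  destruct (HS 0%nat _ _ N1 N2) as (S01 & S02 & S03 & S04).
  destruct (HS 1%nat _ _ N1 N2) as (S11 & S12 & S13 & S14).
  rewrite (laplacian_axial (A 0%nat) (B 0%nat)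
    (fun al s => minus (scal (2 * INR 1 - 1) (B 0%nat al s))
                       (scal (2 * INR 1 * s) (B 1%nat al s)))
    (fun al s => scal (2 * INR 1) (A 1%nat al s))
    (fun al s => scal (- INR 1) (A 1%nat al s))
    (fun al s => scal (- INR 1) (B 1%nat al s)) f a s0 e y _ _ _ _
    (fun al s Ha Hs => match HS 0%nat al s Ha Hs with
       | conj X1 (conj X2 (conj X3 X4)) => conj X4 (conj X3 (conj X2 X1)) end) Hf Ny
    (is_hderive_minus _ _ _ _ _ (is_hderive_scal_const _ _ _ _ S03)
       (is_hderive_scal_const _ _ _ _ S13))
    (is_hderive_scal_const _ _ _ _ S14)
    (is_hderive_scal_const _ _ _ _ S12)
    (is_hderive_scal_const _ _ _ _ S11)).
  unfold axial; clear.
  generalize (A 1%nat (hre y) (hdot y y)), (A 2%nat (hre y) (hdot y y)),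
    (B 1%nat (hre y) (hdot y y)), (B 2%nat (hre y) (hdot y y)), (hdot y y).
  intros [[[? ?] ?] ?] [[[? ?] ?] ?] [[[? ?] ?] ?] [[[? ?] ?] ?] s.
  destruct y as [[[? ?] ?] ?]; unfold_H; apply H_eq; ring. }
destruct (Nx) as [N1 N2].
destruct (HS 0%nat _ _ N1 N2) as (S01 & S02 & S03 & S04).
destruct (HS 1%nat _ _ N1 N2) as (S11 & S12 & S13 & S14).
destruct (HS 2%nat _ _ N1 N2) as (S21 & S22 & S23 & S24).
rewrite (CRF_conj_axial _ _ _ a s0 e x _ _ _ _ Lf Nx
  (is_hderive_scal_const _ _ _ _ S14) (is_hderive_scal_const _ _ _ _ S13)
  (is_hderive_scal_const _ _ _ _ S12) (is_hderive_scal_const _ _ _ _ S11)).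
rewrite (laplacian_axial _ _
  (fun al s => minus (scal (2 * INR 1) (A 1%nat al s))
                     (scal (2 * s) (scal (2 * INR 2) (A 2%nat al s))))
  (fun al s => scal 2 (minus (scal (2 * INR 2 - 1) (B 1%nat al s))
                             (scal (2 * INR 2 * s) (B 2%nat al s))))
  (fun al s => minus (scal (- INR 1) (B 1%nat al s))
     (plus (scal 2 (B 1%nat al s)) (scal (2 * s) (scal (- INR 2) (B 2%nat al s)))))
  (fun al s => scal 2 (scal (- INR 2) (A 2%nat al s))) f' a s0 e x
  _ _ _ _
  (fun al s Ha Hs => match HS 0%nat al s Ha Hs, HS 1%nat al s Ha Hs with
     | conj X1 (conj X2 (conj X3 X4)), conj Y1 (conj Y2 (conj Y3 Y4)) =>
       conj (is_hderive_minus _ _ _ _ _ X3 (is_hderive_scal_const _ _ _ _ Y3))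
      (conj (is_hderive_scal_const _ _ _ _ Y4)
      (conj (is_hderive_minus _ _ _ _ _ X1 (is_hderive_scal_id _ _ _ _ Y1))
            (is_hderive_scal_const _ _ _ _ Y2))) end) Hf' Nx
  (is_hderive_minus _ _ _ _ _ (is_hderive_scal_const _ _ _ _ S14)
     (is_hderive_scal_const _ _ _ _ (is_hderive_scal_const _ _ _ _ S24)))
  (is_hderive_scal_const _ _ _ _ (is_hderive_minus _ _ _ _ _
     (is_hderive_scal_const _ _ _ _ S13) (is_hderive_scal_const _ _ _ _ S23)))
  (is_hderive_minus _ _ _ _ _ (is_hderive_scal_const _ _ _ _ S11)
     (is_hderive_plus _ _ _ _ _ (is_hderive_scal_const _ _ _ _ S11)
        (is_hderive_scal_id _ _ _ _ (is_hderive_scal_const _ _ _ _ S21))))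
  (is_hderive_scal_const _ _ _ _ (is_hderive_scal_const _ _ _ _ S22))).
clear.
generalize (A 2%nat (hre x) (hdot x x)), (A 3%nat (hre x) (hdot x x)),
  (B 1%nat (hre x) (hdot x x)), (B 2%nat (hre x) (hdot x x)),
  (B 3%nat (hre x) (hdot x x)), (hdot x x).
intros [[[? ?] ?] ?] [[[? ?] ?] ?] [[[? ?] ?] ?] [[[? ?] ?] ?] [[[? ?] ?] ?] s.
destruct x as [[[? ?] ?] ?]; unfold_H; apply H_eq; field.
Qed.

Theorem mainTheorem14 :
  forall (D : C -> Prop) (f f' : H -> H),
    axially_symmetric_domain D ->
    slice_regular D f ->
    is_slice_derivative D f f' ->
    forall x : H, Omega D x -> CRF_conj (laplacian f) x = laplacian f' x.
Proof.
intros D f f' (OD & CD & _) (F & SF & HF & IF) (F2 & SF2 & CF2 & IF2 & If2) x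
  (al & be & J & Dz & HJ & Ex).
(* The slice derivative may come with another stem than the holomorphic one; both induce [f], so
   they agree on [D] and so do their derivatives. *)
assert (If' : induces D (dz F) f').
{ intros al' be' J' Dz' HJ'; rewrite (If2 al' be' J' Dz' HJ').
  now rewrite (dz_ext D F2 F OD (stem_unique D F2 F f IF2 IF) _ Dz'). }
(* The local representation is stated in the closed upper half-plane; conjugation invariance moves
   the base point there. *)
assert (Db : D (al, Rabs be)).
{ unfold Rabs; destruct (Rcase_abs be); [ exact (CD _ Dz) | exact Dz ]. }
destruct (local_representation_H D F al (Rabs be) OD (Rabs_pos be) Db SF HF)
  as (e & A & B & He & HS & HR).
apply (CRF_conj_laplacian_axial f f' al (Rabs be * Rabs be) e A B); trivial.
- exact (induces_axial D F f _ _ _ _ _ IF HR).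
- exact (induces_axial D (dz F) f' _ _ _ _ _ If'
    (dz_local_representation D F _ _ _ A B HF HS HR)).
- subst x; destruct J as [[[j0 j1] j2] j3]; apply sphereS_coord in HJ; destruct HJ as [-> HJ].
  split.
  + replace (hre _) with al by (unfold_H; ring).
    now rewrite Rminus_diag, Rabs_R0.
  + replace (hdot _ _) with (Rabs be * Rabs be).
    * now rewrite Rminus_diag, Rabs_R0.
    * rewrite <- Rabs_mult, Rabs_pos_eq by apply Rle_0_sqr.
      transitivity (be * be * (j1 * j1 + j2 * j2 + j3 * j3));
        [ rewrite HJ; ring | unfold_H; ring ].
Qed.
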